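(* Let $R$ be a commutative ring with unit and let $\mathscr G$ be an ample groupoid (not necessarily Hausdorff). Let $\mathcal E=(E,p)$ be a $\mathscr G$-sheaf of $R$-modules, with stalks $E_u=p^{-1}(u)$ regarded as $RG_u$-modules for $u\in\mathscr G^{(0)}$. Then $$\mathrm{Ann}(\Gamma_c(\mathcal E))=\bigcap_{u\in \mathscr G^{(0)}} \mathrm{Ann}(\mathrm{Ind}_u(E_u)),$$ where annihilators are taken in $R\mathscr G$. Consequently, every (two-sided) ideal $I$ of $R\mathscr G$ is an intersection of annihilators of induced modules, i.e., of ideals of the form $\mathrm{Ann}(\mathrm{Ind}_u(M))$ with $u\in\mathscr G^{(0)}$ and $M$ an $RG_u$-module.
   Context: Compactness includes the Hausdorff axiom; locally compact spaces are not required to be Hausdorff. A topological groupoid $\mathscr G=(\mathscr G^{(0)},\mathscr G^{(1)})$, with domain map $\boldsymbol d$ and range map $\boldsymbol r$ and product $\gamma\eta$ defined when $\boldsymbol d(\gamma)=\boldsymbol r(\eta)$, is étale if $\boldsymbol d$ is a local homeomorphism; objects are identified with identity arrows, so $\mathscr G^{(0)}$ is an open subspace of $\mathscr G^{(1)}$. An étale groupoid is ample if $\mathscr G^{(0)}$ is locally compact Hausdorff with a basis of compact open subsets ($\mathscr G^{(1)}$ need not be Hausdorff). Groupoid algebra: $R\mathscr G$ is the $R$-span in $R^{\mathscr G^{(1)}}$ of the characteristic functions $1_U$ of compact open (in particular Hausdorff) subsets $U\subseteq \mathscr G^{(1)}$, with convolution product $f\ast g(\gamma)=\sum_{\alpha\beta=\gamma}f(\alpha)g(\beta)$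 (the sums are finite). It is an associative $R$-algebra with local units, not necessarily unital. A left module $M$ over a ring $S$ with local units is unitary if $SM=M$; for a unital ring this means $1m=m$ for all $m$. Induction: for $u\in\mathscr G^{(0)}$, $G_u=\{\gamma\in\mathscr G^{(1)}\mid \boldsymbol d(\gamma)=u=\boldsymbol r(\gamma)\}$ is the isotropy group at $u$ and $RG_u$ its group ring. Let $\mathscr Gu=\boldsymbol d^{-1}(u)$ and let $R\mathscr Gu$ be the free $R$-module on $\mathscr Gu$. It is an $R\mathscr G$-$RG_u$-bimodule: $G_u$ acts on the right by multiplication, and $f\in R\mathscr G$ acts on the left by $f\alpha=\sum_{\boldsymbol d(\gamma)=\boldsymbol r(\alpha)}f(\gamma)\gamma\alpha$ for $\alpha\in\mathscr Gu$. For a unitary left $RG_u$-module $M$, the induced module is the left $R\mathscr G$-module $\mathrm{Ind}_u(M)=R\mathscr Gu\otimes_{RG_u}M$. Sheaves: a $\mathscr G$-sheaf $\mathcal E=(E,p)$ consists of a space $E$, a local homeomorphism $p\colon E\to\mathscr G^{(0)}$ and a continuous action map $\mathscr G^{(1)}\times_{\mathscr G^{(0)}}E\to E$, $(\gamma,e)\mapsto\gamma e$ (fiber product with respect to $\boldsymbol d$ and $p$), such that $p(e)e=e$ for all $e\in E$; $p(\gamma e)=\boldsymbol r(\gamma)$ whenever $p(e)=\boldsymbol d(\gamma)$; and $\gamma(\eta e)=(\gamma\eta)e$ whenever $p(e)=\boldsymbol d(\eta)$ and $\boldsymbol d(\gamma)=\boldsymbol r(\eta)$. A $\mathscr G$-sheaf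 of $R$-modules is a $\mathscr G$-sheaf together with an $R$-module structure on each stalk $E_u=p^{-1}(u)$ such that the zero section $u\mapsto 0_u$ is continuous, addition $E\times_{\mathscr G^{(0)}}E\to E$ is continuous, scalar multiplication $R\times E\to E$ is continuous ($R$ discrete), and for each $\gamma\in\mathscr G^{(1)}$ the map $E_{\boldsymbol d(\gamma)}\to E_{\boldsymbol r(\gamma)}$, $e\mapsto\gamma e$, is $R$-linear. In particular each $E_u$ is an $RG_u$-module via the action of $G_u$. Sections: a section is a continuous map $s\colon\mathscr G^{(0)}\to E$ with $p\circ s=\mathrm{id}$; its support is the (closed) set $\{u\mid s(u)\neq 0_u\}$. $\Gamma_c(\mathcal E)$ is the $R$-module of sections with compact support (pointwise operations), which is a unitary left $R\mathscr G$-module via $(fs)(u)=\sum_{\boldsymbol r(\gamma)=u}f(\gamma)\,\gamma s(\boldsymbol d(\gamma))$. For a left $R\mathscr G$-module $M$, $\mathrm{Ann}(M)=\{f\in R\mathscr G\mid fM=0\}$. *)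

(* Defs.v *)
From HB Require Import structures.
From mathcomp Require Import all_boot all_order all_algebra.
From mathcomp Require Import generic_quotient ring_quotient finmap.
From mathcomp Require Import boolp classical_sets functions cardinality fsbigop.
From mathcomp Require Import topology numfun.

Set Implicit Arguments.
Unset Strict Implicit.
Unset Printing Implicit Defensive.

Import GRing.Theory.
Local Open Scope classical_set_scope.
Local Open Scope ring_scope.

Section FreeModule.
Context (R : pzRingType) (T : choiceType).

Definition fin_supp : {pred T -> R} :=
  fun f => `[< finite_set (f @^-1` [set~ 0]) >].

Lemma fin_supp_zmod : zmod_closed fin_supp.
Proof.
split=> [|f g /asboolP ff /asboolP fg]; apply/asboolP.
  by apply: (sub_finite_set _ (finite_set0 T)) => t /=.
apply: (@sub_finite_set _ _ (f @^-1` [set~ 0] `|` g @^-1` [set~ 0])); last first.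
  by rewrite finite_setU.
move=> t /= fg0; have [f0|] := eqVneq (f t) 0; last by move/eqP; left.
by right=> g0; apply: fg0; rewrite [LHS]/(f t - g t) f0 g0; exact: subrr.
Qed.

HB.instance Definition _ :=
  GRing.isZmodClosed.Build (T -> R) fin_supp fin_supp_zmod.

Record freeMod := FreeMod { fmval :> T -> R; fmvalP : fmval \in fin_supp }.

HB.instance Definition _ := [isSub for fmval].
HB.instance Definition _ := [Choice of freeMod by <:].
HB.instance Definition _ := [SubChoice_isSubZmodule of freeMod by <:].

Lemma fmP (x y : freeMod) : x =1 y <-> x = y.
Proof. by split=> [xy|->//]; apply/val_inj/funext. Qed.

Lemma fmscale_subproof (a : R) (x : freeMod) : (fun t => a * x t) \in fin_supp.
Proof.
apply/asboolP; apply: sub_finite_set (asboolW (fmvalP x)) => t /= + x0.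
by apply; rewrite x0 mulr0.
Qed.

Definition fmscale a x := FreeMod (fmscale_subproof a x).

Fact fmscaleA a b x : fmscale a (fmscale b x) = fmscale (a * b) x.
Proof. by apply/fmP => t; rewrite /= mulrA. Qed.

Fact fmscale1 : left_id 1 fmscale.
Proof. by move=> x; apply/fmP => t; rewrite /= mul1r. Qed.

Fact fmscaleDr : right_distributive fmscale +%R.
Proof. by move=> a x y; apply/fmP => t; rewrite /= [LHS]mulrDr. Qed.

Fact fmscaleDl x : {morph fmscale^~ x : a b / a + b}.
Proof. by move=> a b; apply/fmP => t; rewrite /= mulrDl. Qed.

HB.instance Definition _ := GRing.Zmodule_isLmodule.Build R freeMod
  fmscaleA fmscale1 fmscaleDr fmscaleDl.

End FreeModule.

Section FreeModuleTheory.
Context (R : pzRingType) (T : choiceType).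
Implicit Types (x y : freeMod R T) (V : lmodType R).

Lemma fbasis_subproof (t : T) : (fun s => (s == t)%:R) \in @fin_supp R T.
Proof.
apply/asboolP; apply: (@sub_finite_set _ _ [set t]); last exact: finite_set1.
by move=> s /=; have [->//|] := eqVneq s t.
Qed.

Definition fbasis (t : T) : freeMod R T := FreeMod (fbasis_subproof t).

(* Sums of the form [\sum_(t \in X) F t] run over the support of [F] in [X], and
   are 0 by convention when that support is infinite. *)
Definition lin_ext V (phi : T -> V) (x : freeMod R T) : V :=
  \sum_(t \in [set: T]) x t *: phi t.

Definition fsupp x : {fset T} := fset_set (x @^-1` [set~ 0]).

Lemma fsuppPn x t : t \notin fsupp x -> x t = 0.
Proof.
have xfin := asboolW (fmvalP x).
move=> /negP tx; apply: contrapT => xt; apply: tx.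
by rewrite in_fset_set// inE.
Qed.

Lemma lin_extEw V (phi : T -> V) x (A : {fset T}) :
  {subset fsupp x <= A} -> lin_ext phi x = \sum_(t <- A) x t *: phi t.
Proof.
move=> xA; apply: fsbigTE => t tA; rewrite (fsuppPn (x := x)) ?scale0r//.
by apply: contra tA; exact: xA.
Qed.

Lemma lin_ext_is_linear V (phi : T -> V) : linear (lin_ext phi).
Proof.
move=> a x y; pose A := (fsupp (a *: x + y)%R `|` fsupp x `|` fsupp y)%fset.
rewrite !(@lin_extEw _ _ _ A); first last.
- by move=> t tx; rewrite !inE tx.
- by move=> t tx; rewrite !inE tx orbT.
- by move=> t tx; rewrite !inE tx orbT.
rewrite scaler_sumr -big_split/=; apply: eq_bigr => t _.
by rewrite scalerA -scalerDl.
Qed.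

HB.instance Definition _ V phi :=
  GRing.isLinear.Build R (freeMod R T) V *:%R (@lin_ext V phi)
    (lin_ext_is_linear phi).

Lemma lin_extZ V (phi : T -> V) a x : lin_ext phi (a *: x) = a *: lin_ext phi x.
Proof. exact: linearZ. Qed.

Lemma lin_ext_basis V (phi : T -> V) t : lin_ext phi (fbasis t) = phi t.
Proof.
rewrite (@lin_extEw _ _ _ [fset t]%fset); last first.
  move=> s; rewrite in_fset_set; last exact: (asboolW (fmvalP (fbasis t))).
  by rewrite !inE/=; have [//|_] := eqVneq s t; case.
by rewrite big_seq_fset1/= eqxx scale1r.
Qed.

Lemma eq_lin_ext V (phi psi : T -> V) : phi =1 psi -> lin_ext phi =1 lin_ext psi.
Proof. by move=> /funext ->. Qed.

Lemma fm_sumE (I : Type) (r : seq I) (F : I -> freeMod R T) s :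
  (\sum_(i <- r) F i : freeMod R T) s = \sum_(i <- r) F i s.
Proof. by elim/big_ind2: _ => // [y a z b <- <-]. Qed.

Lemma lin_ext_id x : lin_ext fbasis x = x.
Proof.
apply/fmP => s; rewrite (@lin_extEw _ _ _ (fsupp x))//.
rewrite fm_sumE; rewrite [LHS](_ : _ = \sum_(t <- fsupp x) x t * (s == t)%:R)//.
have [sx|sx] := boolP (s \in fsupp x); last first.
  rewrite (fsuppPn sx) big1_seq// => t /= tx.
  by rewrite (negbTE (_ : s != t)) ?mulr0//; apply: contraNneq sx => ->.
rewrite (big_fsetD1 s)//= eqxx mulr1 big1_fset ?addr0// => t.
by rewrite in_fsetD1 eq_sym => /andP[/negbTE ->]; rewrite mulr0.
Qed.

Lemma lin_ext_comp (V W : lmodType R) (f : {linear V -> W}) (phi : T -> V) x :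
  f (lin_ext phi x) = lin_ext (f \o phi) x.
Proof.
rewrite !(@lin_extEw _ _ _ (fsupp x))// raddf_sum.
by apply: eq_bigr => t _; rewrite /= linearZ.
Qed.

End FreeModuleTheory.

Section BilinearExtension.
Context (R : comPzRingType).

Definition conv (A B C : choiceType) (op : A -> B -> C)
    (x : freeMod R A) (y : freeMod R B) : freeMod R C :=
  lin_ext (fun a => lin_ext (fun b => fbasis R (op a b)) y) x.

Section Linearity.
Context (A B C : choiceType) (op : A -> B -> C).

Lemma convDl x1 x2 y : conv op (x1 + x2) y = conv op x1 y + conv op x2 y.
Proof. exact: raddfD. Qed.

Lemma conv_is_linear x : linear (conv op x).
Proof.
move=> a y z; rewrite /conv !(@lin_extEw _ _ _ _ _ (fsupp x))//.
rewrite scaler_sumr -big_split/=; apply: eq_bigr => t _.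
by rewrite linearP scalerDr !scalerA mulrC.
Qed.

HB.instance Definition _ x :=
  GRing.isLinear.Build R (freeMod R B) (freeMod R C) *:%R (conv op x)
    (conv_is_linear x).

Lemma convDr x y1 y2 : conv op x (y1 + y2) = conv op x y1 + conv op x y2.
Proof. exact: raddfD. Qed.

Lemma conv_basis a b : conv op (fbasis R a) (fbasis R b) = fbasis R (op a b).
Proof. by rewrite /conv !lin_ext_basis. Qed.

End Linearity.

Lemma conv1l (A B : choiceType) (op : A -> B -> B) a y :
  op a =1 id -> conv op (fbasis R a) y = y.
Proof.
move=> opE; rewrite /conv lin_ext_basis -[RHS]lin_ext_id.
by apply: eq_lin_ext => b; rewrite opE.
Qed.

Lemma conv1r (A B : choiceType) (op : A -> B -> A) x b :
  op^~ b =1 id -> conv op x (fbasis R b) = x.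
Proof.
move=> opE; rewrite /conv -[RHS]lin_ext_id.
by apply: eq_lin_ext => a; rewrite lin_ext_basis opE.
Qed.

Lemma convA (A B C AB BC ABC : choiceType) (op1 : AB -> C -> ABC)
    (op2 : A -> B -> AB) (op3 : A -> BC -> ABC) (op4 : B -> C -> BC) x y z :
  (forall a b c, op1 (op2 a b) c = op3 a (op4 b c)) ->
  conv op1 (conv op2 x y) z = conv op3 x (conv op4 y z).
Proof.
move=> opA; rewrite /conv lin_ext_comp; apply: eq_lin_ext => a /=.
rewrite !lin_ext_comp; apply: eq_lin_ext => b /=.
rewrite lin_ext_basis lin_ext_comp; apply: eq_lin_ext => c /=.
by rewrite lin_ext_basis opA.
Qed.

End BilinearExtension.

Section GroupRing.
Context (R : comPzRingType) (G : groupType).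

Definition grpRing : Type := freeMod R G.

HB.instance Definition _ := GRing.Lmodule.on grpRing.

Definition grpmul : grpRing -> grpRing -> grpRing := conv (fun g h : G => (g * h)%g).

Fact grpmulA : associative grpmul.
Proof. by move=> x y z; rewrite /grpmul -(convA _ _ _ (fun a b c => esym (mulgA a b c))). Qed.

Fact grpmul1l : left_id (fbasis R (1%g : G)) grpmul.
Proof. by move=> x; apply: conv1l => g; rewrite mul1g. Qed.

Fact grpmul1r : right_id (fbasis R (1%g : G)) grpmul.
Proof. by move=> x; apply: conv1r => g; rewrite mulg1. Qed.

Fact grpmulDl : left_distributive grpmul +%R.
Proof. by move=> x y z; exact: convDl. Qed.

Fact grpmulDr : right_distributive grpmul +%R.
Proof. by move=> x y z; exact: convDr. Qed.

HB.instance Definition _ := GRing.Zmodule_isPzRing.Build grpRing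
  grpmulA grpmul1l grpmul1r grpmulDl grpmulDr.

End GroupRing.

Section Tensor.
(* A right [S]-module is a left module over the converse ring [S^c], with
   [a] times [s] on the right written [s *: a]. *)
Context (S : pzRingType) (A : lmodType S^c) (M : lmodType S).

Local Notation F := (freeMod int (A * M)%type).
Local Notation "a ** m" := (fbasis int (a, m)) (at level 38).

Inductive tens_relator : F -> Prop :=
| TensDl (a b : A) (m : M) : tens_relator ((a + b) ** m - a ** m - b ** m)
| TensDr (a : A) (m n : M) : tens_relator (a ** (m + n) - a ** m - a ** n)
| TensM (a : A) (s : S) (m : M) :
  tens_relator (((s : S^c) *: a) ** m - a ** (s *: m)).

Inductive tens_null : F -> Prop :=
| TensNullR x of tens_relator x : tens_null x
| TensNull0 : tens_null 0
| TensNullB x y of tens_null x & tens_null y : tens_null (x - y).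

Definition tens_rel : {pred F} := fun x => `[< tens_null x >].

Fact tens_rel_zmod : zmod_closed tens_rel.
Proof.
split=> [|x y /asboolP xN /asboolP yN]; apply/asboolP; first exact: TensNull0.
exact: TensNullB.
Qed.

HB.instance Definition _ := GRing.isZmodClosed.Build F tens_rel tens_rel_zmod.

Definition tensor : Type := Quotient.quot tens_rel.

HB.instance Definition _ := GRing.Zmodule.on tensor.

Local Notation pi := (\pi_(Quotient.quot tens_rel)%qT : F -> tensor).

Definition tens (a : A) (m : M) : tensor := pi (a ** m).

Lemma tens_eqP x y : tens_null (x - y) <-> pi x = pi y.
Proof.
split=> [xy|/eqP]; last by rewrite -Quotient.idealrBE => /asboolP.
by apply/eqP; rewrite -Quotient.idealrBE; apply/asboolP.
Qed.

(* The endomorphism of [tensor] induced by [phi] on [A] and the identity on [M]. *)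
Definition tens_map (phi : {linear A -> A}) (t : tensor) : tensor :=
  pi (lin_ext (fun p : A * M => phi p.1 ** p.2) (repr (t : Quotient.quot tens_rel))).

Lemma tens_map_pi (phi : {linear A -> A}) x :
  tens_map phi (pi x) = pi (lin_ext (fun p : A * M => phi p.1 ** p.2) x).
Proof.
apply/tens_eqP; rewrite -raddfB.
have /tens_eqP : pi (repr (pi x : Quotient.quot tens_rel)) = pi x by exact: reprK.
elim=> [_ [a b m|a m n|a s m]||{}x y _ + _]; rewrite ?(raddfB, raddf0)/=.
- by rewrite !lin_ext_basis/= raddfD; exact/TensNullR/TensDl.
- by rewrite !lin_ext_basis/=; exact/TensNullR/TensDr.
- by rewrite !lin_ext_basis/= linearZ; exact/TensNullR/TensM.
- exact: TensNull0.
- exact: TensNullB.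
Qed.

Lemma tens_map_tens phi a m : tens_map phi (tens a m) = tens (phi a) m.
Proof. by rewrite tens_map_pi lin_ext_basis. Qed.

Lemma tens_mapD phi : {morph tens_map phi : t u / t + u}.
Proof.
move=> t u; have piD x y : pi (x + y) = pi x + pi y.
  exact: (raddfD \pi_(Quotient.quot tens_rel)%qT).
have piK v : pi (repr (v : Quotient.quot tens_rel)) = v by exact: reprK.
by rewrite -(piK t) -(piK u) -piD !tens_map_pi raddfD piD.
Qed.

End Tensor.

(* [gmul g h] is only meaningful when [dom g = rng h]; all axioms, including
   continuity, are restricted to composable pairs. Objects and arrows are kept
   apart: [idm] embeds the space of objects into the space of arrows. *)
Record topGroupoid := TopGroupoid {
  obj : topologicalType;
  arr : topologicalType;
  dom : arr -> obj;
  rng : arr -> obj;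
  idm : obj -> arr;
  gmul : arr -> arr -> arr;
  ginv : arr -> arr;
  dom_idm : forall u, dom (idm u) = u;
  rng_idm : forall u, rng (idm u) = u;
  dom_gmul : forall g h, dom g = rng h -> dom (gmul g h) = dom h;
  rng_gmul : forall g h, dom g = rng h -> rng (gmul g h) = rng g;
  gmulA : forall g h k, dom g = rng h -> dom h = rng k ->
    gmul g (gmul h k) = gmul (gmul g h) k;
  gmul1g : forall g, gmul (idm (rng g)) g = g;
  gmulg1 : forall g, gmul g (idm (dom g)) = g;
  dom_ginv : forall g, dom (ginv g) = rng g;
  rng_ginv : forall g, rng (ginv g) = dom g;
  gmulVg : forall g, gmul (ginv g) g = idm (dom g);
  gmulgV : forall g, gmul g (ginv g) = idm (rng g);
  continuous_dom : continuous dom;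
  continuous_rng : continuous rng;
  continuous_idm : continuous idm;
  continuous_gmul : {within [set p : arr * arr | dom p.1 = rng p.2],
    continuous (fun p => gmul p.1 p.2)};
  continuous_ginv : continuous ginv
}.

Definition local_homeo (X Y : topologicalType) (f : X -> Y) :=
  forall x, exists (U : set X) (g : Y -> X),
    [/\ open U, U x & open (f @` U)] /\
    [/\ {within U, continuous f}, {within f @` U, continuous g} &
        forall z, U z -> g (f z) = z].

(* Compactness includes the Hausdorff axiom, for the subspace topology. *)
Definition hcompact (X : topologicalType) (A : set X) :=
  compact A /\ hausdorff_space (set_type A).

Definition etale (G : topGroupoid) := local_homeo (@dom G).

Definition ample (G : topGroupoid) :=
  [/\ etale G, hausdorff_space (obj G), locally_compact [set: obj G] &
      exists2 B : set (set (obj G)), basis B & forall U, B U -> hcompact U].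

Section GroupoidAlgebra.
Context (R : comPzRingType) (G : topGroupoid).

(* The elements of the groupoid algebra, as functions on the space of arrows;
   convolution, the module actions below and their sums are only used on
   functions satisfying [galg], for which all supports are finite. *)
Definition galg : set (arr G -> R) := [set f |
  exists (n : nat) (a : 'I_n -> R) (U : 'I_n -> set (arr G)),
    (forall i, open (U i) /\ hcompact (U i)) /\
    f = (fun g => \sum_(i < n) a i * \1_(U i) g)].

Definition gconv (f1 f2 : arr G -> R) : arr G -> R := fun g =>
  \sum_(p \in [set p : arr G * arr G | dom p.1 = rng p.2 /\ gmul p.1 p.2 = g])
    f1 p.1 * f2 p.2.

Definition galg_ideal (I : set (arr G -> R)) :=
  [/\ I `<=` galg, I 0,
      forall f1 f2, I f1 -> I f2 -> I (f1 - f2) &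
      forall f h, I f -> galg h -> I (gconv h f) /\ I (gconv f h)].

(* Annihilator in the groupoid algebra of a module with underlying set [M],
   zero element [z] and action [act]. *)
Definition ann (X : Type) (M : set X) (z : X) (act : (arr G -> R) -> X -> X) :
    set (arr G -> R) :=
  [set f | galg f /\ forall m, M m -> act f m = z].

End GroupoidAlgebra.

Section Isotropy.
Context (G : topGroupoid) (u : obj G).

Definition isot : Type := set_type [set g : arr G | dom g = u /\ rng g = u].

HB.instance Definition _ := Choice.on isot.

Lemma isotP (g : isot) : dom (val g) = u /\ rng (val g) = u.
Proof. exact: set_mem (valP g). Qed.

Definition mk_isot g (du : dom g = u) (ru : rng g = u) : isot :=
  exist _ g (mem_set (conj du ru)).

Fact isot_mul_subproof (g h : isot) :
  dom (gmul (val g) (val h)) = u /\ rng (gmul (val g) (val h)) = u.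
Proof.
have [[dg rg] [dh rh]] := (isotP g, isotP h).
by rewrite dom_gmul ?rng_gmul ?dg ?rh.
Qed.

Definition isot_mul (g h : isot) : isot :=
  mk_isot (isot_mul_subproof g h).1 (isot_mul_subproof g h).2.

Definition isot_one : isot := mk_isot (dom_idm u) (rng_idm u).

Definition isot_inv (g : isot) : isot :=
  mk_isot (etrans (dom_ginv _) (isotP g).2) (etrans (rng_ginv _) (isotP g).1).

Fact isot_mulA : associative isot_mul.
Proof.
move=> g h k; apply/val_inj => /=.
have [[[dg rg] [dh rh]] [dk rk]] := (isotP g, isotP h, isotP k).
by rewrite gmulA ?dg ?rh ?dh ?rk.
Qed.

Fact isot_mul1l : left_id isot_one isot_mul.
Proof. move=> g; apply/val_inj.
by have := gmul1g (val g); rewrite (isotP g).2. Qed.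

Fact isot_mul1r : right_id isot_one isot_mul.
Proof. move=> g; apply/val_inj.
by have := gmulg1 (val g); rewrite (isotP g).1. Qed.

Fact isot_mulV : left_inverse isot_one isot_inv isot_mul.
Proof. by move=> g; apply/val_inj; rewrite /= gmulVg (isotP g).1. Qed.

Fact isot_mulgV : right_inverse isot_one isot_inv isot_mul.
Proof. by move=> g; apply/val_inj; rewrite /= gmulgV (isotP g).2. Qed.

HB.instance Definition _ := isGroup.Build isot
  isot_mulA isot_mul1l isot_mul1r isot_mulV isot_mulgV.

End Isotropy.

Section Induction.
Context (R : comPzRingType) (G : topGroupoid) (u : obj G).

Local Notation RGu := (grpRing R (isot u)).

(* [dfib] is the fibre of [dom] over [u], and [freeDfib] the bimodule free over
   [R] on it: the isotropy group acts on the right, arrows act on the left. *)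
Definition dfib : Type := set_type [set g : arr G | dom g = u].

HB.instance Definition _ := Choice.on dfib.

Lemma dfibP (a : dfib) : dom (val a) = u.
Proof. exact: set_mem (valP a). Qed.

Definition mk_dfib g (du : dom g = u) : dfib := exist _ g (mem_set du).

Fact dfib_mul_subproof (a : dfib) (g : isot u) : dom (gmul (val a) (val g)) = u.
Proof. by rewrite dom_gmul ?dfibP ?(isotP g).1 ?(isotP g).2. Qed.

Definition dfib_mul a g : dfib := mk_dfib (dfib_mul_subproof a g).

Definition freeDfib : Type := freeMod R dfib.

HB.instance Definition _ := GRing.Zmodule.on freeDfib.

Definition freeDfib_scale (s : RGu^c) (x : freeDfib) : freeDfib :=
  conv dfib_mul x s.

Fact freeDfib_scaleA s t x :
  freeDfib_scale s (freeDfib_scale t x) = freeDfib_scale (s * t) x.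
Proof.
apply: convA => a g h; apply/val_inj => /=.
by rewrite gmulA ?dfibP ?(isotP g).2 ?(isotP g).1 ?(isotP h).2.
Qed.

Fact freeDfib_scale1 : left_id 1 freeDfib_scale.
Proof.
move=> x; apply: conv1r => a; apply/val_inj.
by have := gmulg1 (val a); rewrite (dfibP a).
Qed.

Fact freeDfib_scaleDr : right_distributive freeDfib_scale +%R.
Proof. by move=> s x y; exact: convDl. Qed.

Fact freeDfib_scaleDl x : {morph freeDfib_scale^~ x : s t / s + t}.
Proof. by move=> s t; exact: convDr. Qed.

HB.instance Definition _ := GRing.Zmodule_isLmodule.Build RGu^c freeDfib
  freeDfib_scaleA freeDfib_scale1 freeDfib_scaleDr freeDfib_scaleDl.

Definition dcomp (v : obj G) : Type := set_type [set g : arr G | dom g = v].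

HB.instance Definition _ v := Choice.on (dcomp v).

Fact dfib_lmul_subproof (a : dfib) (g : dcomp (rng (val a))) :
  dom (gmul (val g) (val a)) = u.
Proof. by rewrite dom_gmul ?dfibP//; exact: set_mem (valP g). Qed.

Definition dfib_lmul (a : dfib) (g : dcomp (rng (val a))) : dfib :=
  mk_dfib (dfib_lmul_subproof g).

Definition freeDfib_act (f : arr G -> R) : freeDfib -> freeDfib :=
  lin_ext (fun a : dfib =>
    \sum_(g \in [set: dcomp (rng (val a))]) f (val g) *: fbasis R (dfib_lmul g)).

Fact eq_sum_dcomp (V : nmodType) (v w : obj G) (F : dcomp v -> V) (F' : dcomp w -> V) :
  v = w -> (forall g h, val g = val h -> F g = F' h) ->
  \sum_(g \in [set: dcomp v]) F g = \sum_(g \in [set: dcomp w]) F' g.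
Proof. by move=> vw; subst w => FF'; apply: eq_fsbigr => g _; exact: FF'. Qed.

Fact raddf_fsbig_inj (V W : zmodType) (I : choiceType) (psi : {additive V -> W})
    (F : I -> V) : injective psi ->
  psi (\sum_(i \in [set: I]) F i) = \sum_(i \in [set: I]) psi (F i).
Proof.
move=> psi_inj; rewrite raddf_sum.
suff -> : finite_support 0 setT F = finite_support 0 setT (psi \o F) by [].
rewrite /finite_support !unlock; congr (fset_set (_ `&` _)).
apply/seteqP; split => i /= + Fi0; apply; last by rewrite Fi0 raddf0.
by apply: psi_inj; rewrite Fi0 raddf0.
Qed.

Fact freeDfib_act_linear f : linear (freeDfib_act f).
Proof.
move=> s x y; rewrite /freeDfib_act raddfD/=; congr (_ + _).
set L := fun a : dfib => _.
have LE a g : L (dfib_mul a g) = conv dfib_mul (L a) (fbasis R g).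
  pose Phi b := lin_ext (fun h => fbasis R (dfib_mul b h)) (fbasis R g).
  have PhiZ c b : lin_ext Phi (c *: fbasis R b) = c *: fbasis R (dfib_mul b g).
    by rewrite linearZ/= lin_ext_basis /Phi lin_ext_basis.
  have Phi_inj : injective (lin_ext Phi).
    apply: (can_inj (g := freeDfib_scale (fbasis R g^-1%g : RGu))) => z.
    apply: (etrans (freeDfib_scaleA (fbasis R g^-1%g : RGu) (fbasis R g : RGu) z)).
    rewrite (_ : _ * _ = 1); first exact: freeDfib_scale1.
    by apply: (etrans (conv_basis _ _ _ _)); rewrite mulgV.
  apply: esym; apply: (etrans (raddf_fsbig_inj _ Phi_inj)).
  apply: eq_sum_dcomp => [|h k hk].
    by rewrite /= rng_gmul// dfibP (isotP g).2.
  apply: (etrans (PhiZ _ _)); rewrite hk; congr (_ *: fbasis R _).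
  apply/val_inj; rewrite /= -hk gmulA ?dfibP ?(isotP g).2//.
  exact: (set_mem (valP h)).
pose act a := lin_ext (fun b => lin_ext (fun g => fbasis R (dfib_mul b g)) s)
  (a : freeMod R dfib).
have actE a : act a = lin_ext (fun g => conv dfib_mul a (fbasis R g)) s.
  rewrite -[act a]/(conv dfib_mul a s) -{1}(lin_ext_id s).
  exact: (lin_ext_comp (conv dfib_mul a)).
apply: (etrans (lin_ext_comp (lin_ext L) _ _)).
apply: (etrans _ (esym (lin_ext_comp (lin_ext (fun b =>
  lin_ext (fun g => fbasis R (dfib_mul b g)) s)) L x))).
apply: eq_lin_ext => a; rewrite /= -[RHS]/(act (L a)) actE lin_ext_comp.
by apply: eq_lin_ext => g /=; rewrite lin_ext_basis LE.
Qed.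

HB.instance Definition _ f :=
  GRing.isLinear.Build RGu^c freeDfib freeDfib *:%R (freeDfib_act f)
    (freeDfib_act_linear f).

Definition ind (M : lmodType RGu) : zmodType := tensor freeDfib M.

Definition ind_act (M : lmodType RGu) (f : arr G -> R) : ind M -> ind M :=
  tens_map (freeDfib_act f).

Definition ann_ind (M : lmodType RGu) : set (arr G -> R) :=
  ann [set: ind M] 0 (@ind_act M).

End Induction.

Record gsheaf (G : topGroupoid) := GSheaf {
  tot : topologicalType;
  pr : tot -> obj G;
  pr_local_homeo : local_homeo pr;
  sact : arr G -> tot -> tot;
  pr_sact : forall g e, pr e = dom g -> pr (sact g e) = rng g;
  sact_idm : forall e, sact (idm (pr e)) e = e;
  sactM : forall g h e, pr e = dom h -> dom g = rng h ->
    sact g (sact h e) = sact (gmul g h) e;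
  continuous_sact : {within [set q : arr G * tot | dom q.1 = pr q.2],
    continuous (fun q => sact q.1 q.2)}
}.

(* The fibrewise module operations are total functions on the whole space [E],
   and [sadd] is only meaningful on pairs in the same stalk. *)
Record gsheafMod (R : comPzRingType) (G : topGroupoid) := GSheafMod {
  sheaf_of :> gsheaf G;
  szero : obj G -> tot sheaf_of;
  sadd : tot sheaf_of -> tot sheaf_of -> tot sheaf_of;
  sopp : tot sheaf_of -> tot sheaf_of;
  sscale : R -> tot sheaf_of -> tot sheaf_of;
  pr_szero : forall u, pr (szero u) = u;
  pr_sadd : forall e f, pr e = pr f -> pr (sadd e f) = pr e;
  pr_sopp : forall e, pr (sopp e) = pr e;
  pr_sscale : forall a e, pr (sscale a e) = pr e;
  saddA : forall e f h, pr e = pr f -> pr f = pr h ->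
    sadd e (sadd f h) = sadd (sadd e f) h;
  saddC : forall e f, pr e = pr f -> sadd e f = sadd f e;
  sadd0 : forall e, sadd (szero (pr e)) e = e;
  saddN : forall e, sadd (sopp e) e = szero (pr e);
  sscaleA : forall a b e, sscale a (sscale b e) = sscale (a * b) e;
  sscale1 : forall e, sscale 1 e = e;
  sscaleDr : forall a e f, pr e = pr f ->
    sscale a (sadd e f) = sadd (sscale a e) (sscale a f);
  sscaleDl : forall a b e, sscale (a + b) e = sadd (sscale a e) (sscale b e);
  continuous_szero : continuous szero;
  continuous_sadd : {within [set q : tot sheaf_of * tot sheaf_of | pr q.1 = pr q.2],
    continuous (fun q => sadd q.1 q.2)};
  continuous_sscale :
    continuous (fun q : discrete_topology R * tot sheaf_of => sscale q.1 q.2);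
  sact_sadd : forall g e f, pr e = dom g -> pr f = dom g ->
    sact g (sadd e f) = sadd (sact g e) (sact g f);
  sact_sscale : forall g a e, pr e = dom g ->
    sact g (sscale a e) = sscale a (sact g e)
}.

Section Stalk.
Context (R : comPzRingType) (G : topGroupoid) (E : gsheafMod R G).

Section StalkModule.
Context (u : obj G).

Definition stalk : Type := set_type [set e : tot E | pr e = u].

HB.instance Definition _ := Choice.on stalk.

Lemma stalkP (e : stalk) : pr (val e) = u.
Proof. exact: set_mem (valP e). Qed.

Definition mk_stalk e (eu : pr e = u) : stalk := exist _ e (mem_set eu).

Definition stalk0 : stalk := mk_stalk (pr_szero E u).

Fact stalk_add_subproof (e f : stalk) : pr (sadd (val e) (val f)) = u.
Proof. by rewrite pr_sadd !stalkP. Qed.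

Definition stalk_add e f : stalk := mk_stalk (stalk_add_subproof e f).

Definition stalk_opp (e : stalk) : stalk :=
  mk_stalk (etrans (pr_sopp _) (stalkP e)).

Definition stalk_scale a (e : stalk) : stalk :=
  mk_stalk (etrans (pr_sscale a _) (stalkP e)).

Fact stalk_addA : associative stalk_add.
Proof. by move=> e f h; apply/val_inj; rewrite /= saddA ?stalkP. Qed.

Fact stalk_addC : commutative stalk_add.
Proof. by move=> e f; apply/val_inj; rewrite /= saddC ?stalkP. Qed.

Fact stalk_add0 : left_id stalk0 stalk_add.
Proof.
by move=> e; apply/val_inj; have := sadd0 (val e); rewrite stalkP.
Qed.

Fact stalk_addN : left_inverse stalk0 stalk_opp stalk_add.
Proof. by move=> e; apply/val_inj; rewrite /= saddN stalkP. Qed.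

HB.instance Definition _ := GRing.isZmodule.Build stalk
  stalk_addA stalk_addC stalk_add0 stalk_addN.

Fact stalk_scaleA a b e : stalk_scale a (stalk_scale b e) = stalk_scale (a * b) e.
Proof. by apply/val_inj; rewrite /= sscaleA. Qed.

Fact stalk_scale1 : left_id 1 stalk_scale.
Proof. by move=> e; apply/val_inj; rewrite /= sscale1. Qed.

Fact stalk_scaleDr : right_distributive stalk_scale +%R.
Proof. by move=> a e f; apply/val_inj; rewrite /= sscaleDr ?stalkP. Qed.

Fact stalk_scaleDl e : {morph stalk_scale^~ e : a b / a + b}.
Proof. by move=> a b; apply/val_inj; rewrite /= sscaleDl. Qed.

HB.instance Definition _ := GRing.Zmodule_isLmodule.Build R stalk
  stalk_scaleA stalk_scale1 stalk_scaleDr stalk_scaleDl.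

End StalkModule.

Definition stalk_act (v u : obj G) (g : arr G) (dg : dom g = v) (rg : rng g = u)
    (e : stalk v) : stalk u :=
  mk_stalk (etrans (pr_sact (etrans (stalkP e) (esym dg))) rg).

Fact stalk_act_linear v u g (dg : dom g = v) (rg : rng g = u) :
  linear (stalk_act dg rg).
Proof.
move=> a e f; apply/val_inj; rewrite /= sact_sadd ?pr_sscale ?stalkP//.
by rewrite sact_sscale ?stalkP.
Qed.

HB.instance Definition _ v u g (dg : dom g = v) (rg : rng g = u) :=
  GRing.isLinear.Build R (stalk v) (stalk u) *:%R (stalk_act dg rg)
    (stalk_act_linear dg rg).

Section IsotropyModule.
Context (u : obj G).

Local Notation RGu := (grpRing R (isot u)).

(* The type [stalk u] keeps its [R]-module structure; [stalkG] is a copy of it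
   carrying the module structure over the group ring of the isotropy group. *)
Definition stalkG : Type := stalk u.

HB.instance Definition _ := GRing.Zmodule.on stalkG.

Definition isot_act (g : isot u) : stalk u -> stalk u :=
  stalk_act (isotP g).1 (isotP g).2.

Definition stalkG_scale (s : RGu) (e : stalkG) : stalkG :=
  lin_ext (fun g : isot u => isot_act g e) s.

Fact stalkG_scaleA s t e :
  stalkG_scale s (stalkG_scale t e) = stalkG_scale (s * t) e.
Proof.
apply: esym; apply: (etrans (lin_ext_comp (lin_ext (fun g => isot_act g e)) _ _)).
apply: eq_lin_ext => g /=; rewrite lin_ext_comp.
apply: esym; apply: (etrans (lin_ext_comp (isot_act g) _ _)).
apply: eq_lin_ext => h /=; rewrite lin_ext_basis; apply/val_inj => /=.
by rewrite sactM ?stalkP ?(isotP h).1 ?(isotP h).2 ?(isotP g).1.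
Qed.

Fact stalkG_scale1 : left_id 1 stalkG_scale.
Proof.
move=> e; apply: (etrans (lin_ext_basis _ _)); apply/val_inj.
by have := sact_idm (val e); rewrite stalkP.
Qed.

Fact stalkG_scaleDr : right_distributive stalkG_scale +%R.
Proof.
move=> s e f; rewrite /stalkG_scale !(@lin_extEw _ _ _ _ _ (fsupp s))//.
by rewrite -big_split/=; apply: eq_bigr => g _; rewrite -scalerDr; congr (_ *: _); apply: (raddfD (isot_act g)).
Qed.

Fact stalkG_scaleDl e : {morph stalkG_scale^~ e : s t / s + t}.
Proof. by move=> s t; exact: raddfD. Qed.

HB.instance Definition _ := GRing.Zmodule_isLmodule.Build RGu stalkG
  stalkG_scaleA stalkG_scale1 stalkG_scaleDr stalkG_scaleDl.

End IsotropyModule.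

(* A section is a family of elements of the stalks, so that [pr \o s = id] holds
   by typing. *)
Definition gammac : set (forall u, stalk u) := [set s : forall u, stalk u |
  continuous (fun u => val (s u) : tot E) /\ hcompact [set u | s u <> 0]].

Definition rfib (u : obj G) : Type := set_type [set g : arr G | rng g = u].

HB.instance Definition _ u := Choice.on (rfib u).

Definition gammac_act (f : arr G -> R) (s : forall u, stalk u) (u : obj G) : stalk u :=
  \sum_(g \in [set: rfib u])
    f (val g) *: stalk_act erefl (set_mem (valP g)) (s (dom (val g))).

Definition ann_gammac : set (arr G -> R) :=
  ann gammac (fun u => 0) gammac_act.

End Stalk.

(* Main.v *)
(* Since [freeDfib R u] is free over the group ring of the isotropy group at [u],
   with basis a transversal of the ranges, [f] annihilates the module induced from
   [M] if and only if, for all arrows [a : u -> v] and [b : u -> w], the element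
   [sum_k f(b k a^-1) k] of the group ring annihilates [M] (ann_indP).

   For [M = E_u] and after transport by [a] and [b], this says that
   [sum_(g : v -> w) f(g) g e = 0] for all [v], [w] and [e] in [E_v]. Summing over [v]
   shows that [f] annihilates the sections. Conversely, apply [f] to a section through
   [e] whose support avoids the finitely many other domains of arrows with range [w]
   at which [f] does not vanish.

   For an ideal [I], let [M_u] be the quotient of the free module on the arrows with
   range [u] by the restrictions of the elements of [I] to these arrows. Conjugating
   [f] by small compact open bisections shows that [I] annihilates the module induced
   from [M_u]. If [f] annihilates all these modules, then on each range fibre [f]
   coincides with an element of [I]; by galg_germ0 it does so over a neighbourhood of
   the base point, and by compactness [f] belongs to [I]. *)

Require Import Defs.
From HB Require Import structures.
From mathcomp Require Import all_boot all_algebra.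
From mathcomp Require Import generic_quotient ring_quotient finmap.
From mathcomp Require Import boolp classical_sets functions cardinality fsbigop.
From mathcomp Require Import topology numfun.

Set Implicit Arguments.
Unset Strict Implicit.
Unset Printing Implicit Defensive.

Import GRing.Theory.
Local Open Scope classical_set_scope.
Local Open Scope ring_scope.

(** * Topological preliminaries *)

Lemma compact_finite_cover (T : topologicalType) (K : set T) (V : T -> set T) :
  compact K -> (forall x, open (V x) /\ V x x) ->
  exists s : seq T, K `<=` [set y | exists2 x, x \in s & V x y].
Proof.
move=> Kc Vx; have [[x0 Kx0]|/set0P/negP/negPn/eqP ->] := pselect (K !=set0);
  last by exists [::].
pose T' : ptopologicalType := HB.pack (Topological.sort T) (isPointed.Build T x0).
have : compact (K : set T') by [].
rewrite compact_cover => /(_ T K V (fun x _ => (Vx x).1)).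
case=> [x Kx|D DK KD]; first by exists x; [exact: Kx|exact: (Vx x).2].
by exists D => y /KD [x Dx Vxy]; exists x.
Qed.

Lemma finite_set_sub1 (T : Type) (A : set T) : is_subset1 A -> finite_set A.
Proof.
move=> A1; have [[x Ax]|/set0P/negP/negPn/eqP ->//] := pselect (A !=set0).
by apply: (@sub_finite_set _ _ [set x]) => // y Ay; exact: A1.
Qed.

(** Finitely many open sets on which [f] is injective cover [K], and each meets the fibre in at most
    one point. *)
Lemma compact_fibre_finite (X : topologicalType) (Y : Type) (f : X -> Y) (K : set X) y :
  (forall x, exists U, [/\ open U, U x & set_inj U f]) -> compact K ->
  finite_set (K `&` [set x | f x = y]).
Proof.
move=> /choice[U Uf] Kc.
have [x|s Ks] := compact_finite_cover (V := U) Kc; first by have [] := Uf x.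
apply: (@sub_finite_set _ _
  [set z | f z = y /\ exists2 x, x \in s & U x z]) => [z [/Ks Kz fz]//|].
elim: s {Ks} => [|x s IHs].
  by apply: (@sub_finite_set _ _ set0) => // z [_ []].
apply: (@sub_finite_set _ _ ((U x `&` [set z | f z = y]) `|`
    [set z | f z = y /\ exists2 x, x \in s & U x z])).
  move=> z [fz [x']]; rewrite inE => /orP[/eqP ->|x's] Uz; first by left.
  by right; split=> //; exists x'.
rewrite finite_setU; split=> //; apply: finite_set_sub1 => z1 z2 [Uz1 fz1] [Uz2 fz2].
have [_ _ Uinj] := Uf x.
by apply: Uinj; rewrite ?inE ?fz1 ?fz2.
Qed.

Lemma open_within_preimage (X Y : topologicalType) (A : set X) (f : X -> Y) W :
  open A -> {within A, continuous f} -> open W -> open (A `&` f @^-1` W).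
Proof.
by move=> Ao; rewrite continuous_open_subspace// => /(continuous_inP f Ao); apply.
Qed.

Lemma open_preimage (X Y : topologicalType) (f : X -> Y) W :
  continuous f -> open W -> open (f @^-1` W).
Proof. by move=> /continuousP; apply. Qed.

(** Disjoint neighbourhoods pull back along [f]. With [f = dom], bisections are Hausdorff even if
    the space of arrows is not. *)
Lemma hausdorff_sub (X Y : topologicalType) (A : set X) (f : X -> Y) :
  hausdorff_space Y -> continuous f -> set_inj A f ->
  hausdorff_space (set_type A).
Proof.
move=> Yh fc Ainj; have jc : continuous (f \o (@set_val _ A)).
  by move=> x; apply: continuous_comp; [exact: initial_continuous|exact: fc].
rewrite open_hausdorff => x y xy; rewrite open_hausdorff in Yh.
have fxy : f (val x) != f (val y).
  apply: contra_neq xy => fxy; apply/val_inj; apply: Ainj => //; exact: valP.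
have [[U V] [/= Ux Vy] [Uo Vo UV0]] := Yh _ _ fxy.
exists ((f \o @set_val _ A) @^-1` U, (f \o @set_val _ A) @^-1` V).
  by rewrite !inE in Ux Vy *.
split; [exact: open_preimage jc _|exact: open_preimage jc _|].
apply/eqP/seteqP; split=> // z [Uz Vz].
by have /eqP/seteqP[+ _] := UV0 => /(_ (f (val z))); apply.
Qed.

Lemma open_hausdorff_separation (X : topologicalType) (A : set X) (x y : X) :
  open A -> hausdorff_space (set_type A) -> A x -> A y -> x <> y ->
  exists U V, [/\ open U, open V, U x, V y & A `&` (U `&` V) = set0].
Proof.
move=> Ao; rewrite open_hausdorff => Ah Ax Ay xy.
have [|[U V] [/= Ux Vy] [[U' U'o UE] [V' V'o VE] UV0]] :=
    Ah (SigSub (mem_set Ax)) (SigSub (mem_set Ay)).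
  by apply/eqP => -[].
exists U', V'; split=> //; [by move: Ux; rewrite -UE inE|by move: Vy; rewrite -VE inE|].
apply/seteqP; split=> // z [Az [U'z V'z]].
have /eqP/seteqP[+ _] := UV0 => /(_ (SigSub (mem_set Az))); apply.
by rewrite -UE -VE.
Qed.

Lemma local_homeoP (X Y : topologicalType) (f : X -> Y) x : local_homeo f ->
  exists (U : set X) (g : Y -> X), [/\ open U, U x, {in U, cancel f g},
    {within f @` U, continuous g} &
    forall W, open W -> open (f @` (U `&` W))].
Proof.
move=> /(_ x)[U [g [[Uo Ux fUo] [fc gc fK]]]]; exists U, g.
split=> //; first by move=> z; rewrite inE => /fK.
move=> W Wo; suff -> : f @` (U `&` W) = f @` U `&` g @^-1` W.
  exact: open_within_preimage.
apply/seteqP; split=> [_ [z [Uz Wz] <-]|y [[z Uz <-]]]; rewrite /= fK//.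
  by split=> //; exists z.
by move=> Wz; exists z.
Qed.

Lemma closed_avoid (X Y : topologicalType) (f : X -> Y) (K : set X) y :
  hausdorff_space Y -> continuous f -> compact K -> ~ (f @` K) y ->
  exists U, [/\ open U, U y & forall x, K x -> ~ U (f x)].
Proof.
move=> Yh fc Kc Ky; exists (~` (f @` K)); split=> //.
  apply: closed_openC; apply: (compact_closed Yh).
  by apply: continuous_compact Kc; exact: continuous_subspaceT.
by move=> x Kx; apply; exists x.
Qed.

(** * Ample groupoids and their bisections *)

Section Groupoid.
Context (G : topGroupoid).
Implicit Types g h k : arr G.

Lemma gmulKl g h : dom g = rng h -> gmul (ginv g) (gmul g h) = h.
Proof. by move=> gh; rewrite gmulA ?dom_ginv// gmulVg gh gmul1g. Qed.

Lemma gmulVKl g h : rng g = rng h -> gmul g (gmul (ginv g) h) = h.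
Proof. by move=> gh; rewrite gmulA ?rng_ginv ?dom_ginv// gmulgV gh gmul1g. Qed.

Lemma gmulKr g h : dom g = rng h -> gmul (gmul g h) (ginv h) = g.
Proof. by move=> gh; rewrite -gmulA ?rng_ginv// gmulgV -gh gmulg1. Qed.

Lemma gmulVKr g h : dom g = dom h -> gmul (gmul g (ginv h)) h = g.
Proof. by move=> gh; rewrite -gmulA ?rng_ginv ?dom_ginv// gmulVg -gh gmulg1. Qed.

Lemma ginvK : involutive (@ginv G).
Proof.
move=> g; rewrite -[LHS]gmulg1 dom_ginv rng_ginv -gmulVg gmulA ?dom_ginv ?rng_ginv//.
by rewrite gmulVg dom_ginv gmul1g.
Qed.

Lemma gmulIg g1 g2 h : dom g1 = rng h -> dom g2 = rng h ->
  gmul g1 h = gmul g2 h -> g1 = g2.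
Proof. by move=> g1h g2h e; rewrite -(gmulKr g1h) e gmulKr. Qed.

Lemma gmulgI g h1 h2 : dom g = rng h1 -> dom g = rng h2 ->
  gmul g h1 = gmul g h2 -> h1 = h2.
Proof. by move=> gh1 gh2 e; rewrite -(gmulKl gh1) e gmulKl. Qed.

Lemma dom_gmulV g h : dom g = dom h -> dom (gmul g (ginv h)) = rng h.
Proof. by move=> gh; rewrite dom_gmul ?dom_ginv ?rng_ginv. Qed.

Lemma rng_gmulV g h : dom g = dom h -> rng (gmul g (ginv h)) = rng g.
Proof. by move=> gh; rewrite rng_gmul ?rng_ginv. Qed.

Lemma dom_gmulVl g h : rng g = rng h -> dom (gmul (ginv g) h) = dom h.
Proof. by move=> gh; rewrite dom_gmul ?dom_ginv. Qed.

Lemma rng_gmulVl g h : rng g = rng h -> rng (gmul (ginv g) h) = dom g.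
Proof. by move=> gh; rewrite rng_gmul ?rng_ginv ?dom_ginv. Qed.

Definition bisection (B : set (arr G)) :=
  [/\ open B, hcompact B, set_inj B (@dom G) & set_inj B (@rng G)].

Section Ample.
Hypothesis ampleG : ample G.

Lemma ample_dom_inj g : exists U, [/\ open U, U g & set_inj U (@dom G)].
Proof.
have [/(@local_homeoP _ _ _ g)[U [s [Uo Ug sK _ _]]] _ _ _] := ampleG.
by exists U; split=> // x y xU yU xy; rewrite -(sK _ xU) xy sK.
Qed.

Lemma ample_rng_inj g : exists U, [/\ open U, U g & set_inj U (@rng G)].
Proof.
have [U [Uo Ug Uinj]] := ample_dom_inj (ginv g).
exists (@ginv G @^-1` U); split=> //.
  exact: open_preimage (@continuous_ginv G) Uo.
move=> x y; rewrite !inE => xU yU xy; apply: (can_inj ginvK).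
by apply: Uinj; rewrite ?inE// !dom_ginv.
Qed.

Lemma ample_basis (u : obj G) (N : set (obj G)) : open N -> N u ->
  exists V, [/\ open V, hcompact V, V u & V `<=` N].
Proof.
move=> No Nu; have [_ _ _ [B [Bo Bnbhs] Bc]] := ampleG.
have [V [BV Vu] VN] := Bnbhs u N (open_nbhs_nbhs (conj No Nu)).
by exists V; split=> //; [exact: Bo|exact: Bc].
Qed.

(** The local inverse [s] of [dom] is restricted to a compact open [V] inside the image of the
    intersection of [U], [U'] and [N]. The image of [V] under [s] is compact, and open as the part
    of [U] over [V]. *)
Lemma bisection_basis g (N : set (arr G)) : open N -> N g ->
  exists B, [/\ bisection B, B g & B `<=` N].
Proof.
move=> No Ng; have [et Gh _ _] := ampleG.
have [U [s [Uo Ug sK sc Uopen]]] := local_homeoP g et.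
have [U' [U'o U'g U'inj]] := ample_rng_inj g.
have Wo := openI U'o No.
have [|V [Vo [Vc _] Vu VW]] := ample_basis (Uopen _ Wo) (u := dom g).
  by exists g.
have VE : U `&` @dom G @^-1` V = s @` V.
  apply/seteqP; split=> [x [Ux Vx]|_ [v Vv <-]].
    by exists (dom x) => //; rewrite sK ?inE.
  by have [x [Ux _] xv] := VW v Vv; rewrite -xv sK ?inE//; split=> //=; rewrite xv.
exists (U `&` @dom G @^-1` V); split=> //; last first.
  rewrite VE => _ [v /VW[x [Ux [_ Nx]] <-] <-].
  by rewrite sK ?inE.
have Binj : set_inj (U `&` @dom G @^-1` V) (@dom G).
  move=> x y; rewrite !inE => -[xU _] [yU _] xy.
  by rewrite -[LHS]sK ?inE// xy sK ?inE.
split=> //.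
- by apply: openI => //; exact: open_preimage (@continuous_dom G) Vo.
- split; last exact: hausdorff_sub Gh (@continuous_dom G) Binj.
  rewrite VE; apply: continuous_compact Vc.
  by apply: continuous_subspaceW sc => v /VW[x [Ux _] <-]; exists x.
- rewrite VE => x y; rewrite !inE => -[v /VW[x' [Ux' [U'x' _]] <-] <-].
  move=> [w /VW[y' [Uy' [U'y' _]] <-] <-]; rewrite !sK ?inE// => xy.
  by apply: U'inj; rewrite ?inE.
Qed.

(** An arrow and the identity at its domain have the same domain, so they coincide once both lie in
    an open set on which [dom] is injective. *)
Lemma unit_nbhs (u : obj G) : exists N : set (arr G),
  [/\ open N, N (idm u) & forall g, N g -> g = idm (dom g)].
Proof.
have [U [Uo Uu Uinj]] := ample_dom_inj (idm u).
have idc : continuous (@idm G \o @dom G).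
  by move=> g; apply: continuous_comp; [exact: continuous_dom|exact: continuous_idm].
exists (U `&` (@idm G \o @dom G) @^-1` U); split.
- by apply: openI => //; exact: open_preimage idc Uo.
- by split=> //=; rewrite dom_idm.
- by move=> g [Ug Ug']; apply: Uinj; rewrite ?inE// dom_idm.
Qed.

End Ample.
End Groupoid.

(** * The groupoid algebra *)

Section Convolution.
Context (R : comPzRingType) (G : topGroupoid).
Implicit Types (f : arr G -> R) (B : set (arr G)).

(** In a factorisation [x y = g] with [x] in [B], injectivity of [rng] forces [x = b]. The factor
    [r] is carried along because [galg_ideal] gives access to scalar multiples only through
    convolution. *)
Lemma gconv_bisl r B f b g : set_inj B (@rng G) -> B b -> rng b = rng g ->
  gconv (fun h => r * \1_B h) f g = r * f (gmul (ginv b) g).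
Proof.
move=> Binj Bb bg; rewrite /gconv -(fsbig_widen [set (b, gmul (ginv b) g)]).
- by rewrite fsbig_set1/= indicE mem_set// mulr1.
- by move=> _ ->/=; rewrite rng_gmulVl// gmulVKl.
- move=> [x y] [/= [xy xyg] nb]; rewrite indicE.
  have [xB|_] := boolP (x \in B); last by rewrite mulr0 mul0r.
  case: nb; have xb : x = b.
    by apply: Binj; rewrite ?(mem_set Bb)// bg -xyg rng_gmul.
  by rewrite -xyg -xb gmulKl.
Qed.

Lemma gconv_bisl0 r B f g : (forall b, B b -> rng b <> rng g) ->
  gconv (fun h => r * \1_B h) f g = 0.
Proof.
move=> Bg; apply: fsbig1 => -[x y] [/= xy xyg]; rewrite indicE.
have [/set_mem/Bg|_] := boolP (x \in B); last by rewrite mulr0 mul0r.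
by rewrite -xyg rng_gmul.
Qed.

Lemma gconv_bisr B f b g : set_inj B (@dom G) -> B b -> dom b = dom g ->
  gconv f \1_B g = f (gmul g (ginv b)).
Proof.
move=> Binj Bb bg; rewrite /gconv -(fsbig_widen [set (gmul g (ginv b), b)]).
- by rewrite fsbig_set1/= indicE mem_set// mulr1.
- by move=> _ ->/=; rewrite dom_gmulV// gmulVKr.
- move=> [x y] [/= [xy xyg] nb]; rewrite indicE.
  have [yB|_] := boolP (y \in B); last by rewrite mulr0.
  case: nb; have yb : y = b.
    by apply: Binj; rewrite ?(mem_set Bb)// bg -xyg dom_gmul.
  by rewrite -xyg -yb gmulKr.
Qed.

Lemma gconv_bisr0 B f g : (forall b, B b -> dom b <> dom g) ->
  gconv f \1_B g = 0.
Proof.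
move=> Bg; apply: fsbig1 => -[x y] [/= xy xyg]; rewrite indicE.
have [/set_mem/Bg|_] := boolP (y \in B); last by rewrite mulr0.
by rewrite -xyg dom_gmul.
Qed.

Lemma galg_scale_indic r B : bisection B -> galg (fun h => r * \1_B h : R).
Proof.
move=> [Bo Bc _ _]; exists 1%N, (fun=> r), (fun=> B); split=> //.
by apply/funext => g; rewrite big_ord1.
Qed.

Lemma galg_indic B : bisection B -> galg (\1_B : arr G -> R).
Proof.
move=> /(galg_scale_indic 1); congr galg.
by apply/funext => g; rewrite mul1r.
Qed.

Lemma galgB f1 f2 : galg f1 -> galg f2 -> galg (f1 - f2).
Proof.
move=> [n1 [a1 [U1 [U1c ->]]]] [n2 [a2 [U2 [U2c ->]]]].
exists (n1 + n2)%N, (fun i : 'I_(n1 + n2) =>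
  match fintype.split i with inl j => a1 j | inr j => - a2 j end).
exists (fun i : 'I_(n1 + n2) => match fintype.split i with inl j => U1 j | inr j => U2 j end).
split=> [i|]; first by case: fintype.split.
apply/funext => g; rewrite big_split_ord/= -[LHS]/(_ - _) -sumrN.
congr (_ + _); apply: eq_bigr => i _; rewrite ?mulNr.
  by rewrite -[lshift _ _]/(unsplit (inl i)) unsplitK.
by rewrite -[rshift _ _]/(unsplit (inr i)) unsplitK mulNr.
Qed.

Lemma galg_support f : galg f ->
  exists2 K : set (arr G), compact K & forall g, f g <> 0 -> K g.
Proof.
move=> [n [a [U [Uc ->]]]]; exists (\big[setU/set0]_(i < n) U i).
  by apply: bigsetU_compact => i _; have [_ []] := Uc i.
move=> g fg; apply: contrapT => nU; apply: fg.
rewrite big1// => i _; rewrite indicE memNset ?mulr0// => Ug.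
by apply: nU; rewrite (bigD1 i)//=; left.
Qed.

Section Ample.
Hypothesis ampleG : ample G.

Lemma galg_finite_dom f u : galg f -> finite_set [set g | dom g = u /\ f g <> 0].
Proof.
move=> /galg_support[K Kc fK].
apply: sub_finite_set (compact_fibre_finite u (ample_dom_inj ampleG) Kc).
by move=> g [gu /fK].
Qed.

Lemma galg_finite_rng f u : galg f -> finite_set [set g | rng g = u /\ f g <> 0].
Proof.
move=> /galg_support[K Kc fK].
apply: sub_finite_set (compact_fibre_finite u (ample_rng_inj ampleG) Kc).
by move=> g [gu /fK].
Qed.

(* Choose a neighbourhood [B k] of each of the finitely many arrows [k] with range
   [u] in the given compact open sets [U i], separating the ones that lie in the
   same (Hausdorff) [U i]. By compactness, if [rng g] is close to [u], then
   [g \in U i] if and only if [g] belongs to [B k] for exactly one [k \in U i];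
   hence [f g] is the sum of the [f k] over the [k] such that [g \in B k]. *)
Lemma galg_germ0 f u : galg f -> (forall g, rng g = u -> f g = 0) ->
  exists N, [/\ open N, N u & forall g, N (rng g) -> f g = 0].
Proof.
move=> [n [a [U [Uc fE]]]] fu0; have [_ Gh _ _] := ampleG.
pose F := [set g | rng g = u /\ exists i, U i g].
have Ffin : finite_set F.
  have Kc : compact (\big[setU/set0]_(i < n) U i).
    by apply: bigsetU_compact => i _; have [_ []] := Uc i.
  apply: sub_finite_set (compact_fibre_finite u (ample_rng_inj ampleG) Kc).
  by move=> g [gu [i Ui]]; split=> //; rewrite (bigD1 i)//=; left.
pose X := fset_set F.
have XP k : (k \in X) = (k \in F) by rewrite in_fset_set.
have /choice[S SP] (t : 'I_n * arr G * arr G) : exists VW : set (arr G) * set (arr G),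
    [/\ nbhs t.1.2 VW.1, nbhs t.2 VW.2 &
     U t.1.1 t.1.2 -> U t.1.1 t.2 -> t.1.2 <> t.2 -> U t.1.1 `&` (VW.1 `&` VW.2) = set0].
  case: t => [[i k] k'] /=.
  have [[Uk Uk' kk']|nU] := pselect [/\ U i k, U i k' & k <> k']; last first.
    by exists (setT, setT); split; [exact: filterT|exact: filterT|move=> *; case: nU].
  have [Uo [_ Uh]] := Uc i.
  have [V [W [Vo Wo Vk Wk' VW]]] := open_hausdorff_separation Uo Uh Uk Uk' kk'.
  by exists (V, W); split; [exact: open_nbhs_nbhs|exact: open_nbhs_nbhs|].
(* The arrow [k] may come first or second in a separated pair, so both components are imposed. *)
pose D k := [set g | forall p : 'I_n * X, (U p.1 k -> U p.1 g) /\
  (S (p.1, k, val p.2)).1 g /\ (S (p.1, val p.2, k)).2 g].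
have Dk k : nbhs k (D k).
  apply: filter_forall => -[i k'] /=.
  have [[So1 _ _] [_ So2 _]] := (SP (i, k, val k'), SP (i, val k', k)).
  apply: filterI; last exact: filterI.
  have [Uk|nUk] := pselect (U i k); last by apply: filterS filterT => g _ /nUk.
  apply: filterS (open_nbhs_nbhs (conj (Uc i).1 Uk)) => g; by [].
pose B k : set (arr G) := interior (D k).
have Bo k : open (B k) by exact: open_interior.
have Bk k : B k k by exact: Dk.
have BU i k g : B k g -> U i k -> k \in X -> U i g.
  move=> /interior_subset Dg Uk kX; exact: (Dg (i, [` kX]%fset)).1.
have B1 i k k' g : k \in X -> k' \in X -> U i k -> U i k' -> B k g -> B k' g -> k = k'.
  move=> kX k'X Uk Uk' Bkg Bk'g; apply: contrapT => kk'.
  have [_ _ /(_ Uk Uk' kk')/seteqP[S0 _]] := SP (i, k, k').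
  apply: (S0 g); split; first exact: BU Bkg Uk kX.
  split.
    exact: (interior_subset Bkg (i, [` k'X]%fset)).2.1.
  exact: (interior_subset Bk'g (i, [` kX]%fset)).2.2.
have /choice[N NP] i : exists N, [/\ open N, N u &
    forall g, U i g -> N (rng g) -> exists k, [/\ k \in X, U i k & B k g]].
  (* What the sets [B k] leave of [U i] is compact and misses the range fibre of [u], so its ranges
     avoid a neighbourhood of [u]. *)
  pose O := \bigcup_(k in [set k | k \in X /\ U i k]) B k.
  have [_ [Uic _]] := Uc i.
  have Kc : compact (U i `&` ~` O).
    apply: compact_closedI => //; apply: open_closedC.
    exact: bigcup_open.
  have [|N [No Nu NK]] := closed_avoid Gh (@continuous_rng G) Kc (y := u).
    move=> [g [Ug nO] gu]; apply: nO; exists g => //; split=> //.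
    by rewrite XP inE; split=> //; exists i.
  exists N; split=> // g Ug Ng; apply: contrapT => nk; apply: (NK g) => //.
  by split=> // -[k [kX Uk] Bkg]; apply: nk; exists k.
have : nbhs u [set v | forall i, N i v].
  by apply: filter_forall => i; have [No Nu _] := NP i; exact: open_nbhs_nbhs.
rewrite nbhsE => -[W [Wo Wu WN]]; exists W; split=> // g Wg.
have UE i : \1_(U i) g = \sum_(k <- X) \1_(U i) k * \1_(B k) g :> R.
  have [Ug|nUg] := pselect (U i g); last first.
    rewrite indicE memNset// big_seq big1// => k kX; rewrite !indicE.
    have [/set_mem Uk|_] := boolP (k \in U i); last by rewrite mul0r.
    have [/set_mem Bkg|_] := boolP (g \in B k); last by rewrite mulr0.
    by case: nUg; exact: BU Bkg Uk kX.
  have [_ _ /(_ g Ug (WN _ Wg i))[k [kX Uk Bkg]]] := NP i.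
  rewrite (bigD1_seq k)//= !indicE !mem_set// mul1r big_seq_cond big1 ?addr0//.
  move=> k' /andP[k'X k'k]; rewrite !indicE.
  have [/set_mem Uk'|_] := boolP (k' \in U i); last by rewrite mul0r.
  have [/set_mem Bk'g|_] := boolP (g \in B k'); last by rewrite mulr0.
  by case/eqP: k'k; exact: (B1 i k' k g).
transitivity (\sum_(k <- X) f k * \1_(B k) g).
  rewrite fE; under [RHS]eq_bigr do rewrite mulr_suml.
  rewrite exchange_big/=; apply: eq_bigr => i _; rewrite UE mulr_sumr.
  by apply: eq_bigr => k _; rewrite mulrA.
rewrite big_seq big1// => k; rewrite XP inE => -[ku _].
by rewrite fu0// mul0r.
Qed.

End Ample.
End Convolution.

(** * Annihilators of induced modules *)

Lemma fsum_finite (V : nmodType) (I : choiceType) (F : I -> V) (A : set I) :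
  finite_set A -> (forall i, ~ A i -> F i = 0) ->
  \sum_(i \in [set: I]) F i = \sum_(i <- fset_set A) F i.
Proof.
move=> Afin AF; apply: fsbigTE => i; rewrite in_fset_set// => /negP iA.
by apply: AF => Ai; apply: iA; rewrite inE.
Qed.

Lemma fsum1 (V : nmodType) (I : choiceType) (F : I -> V) (i : I) :
  (forall j, j <> i -> F j = 0) -> \sum_(j \in [set: I]) F j = F i.
Proof.
move=> Fi; rewrite -(fsbig_widen [set i]) ?fsbig_set1// => j [_ /= ji].
exact: Fi.
Qed.

(** * Coordinates in free modules *)

Section FreeModuleEval.
Context (R : pzRingType) (T T' : choiceType).
Implicit Types (x : freeMod R T) (y : freeMod R T') (phi : T -> T').

Lemma lin_extE (V : lmodType R) (h : T -> V) x :
  lin_ext h x = \sum_(t <- fsupp x) x t *: h t.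
Proof. exact: lin_extEw. Qed.

Lemma mem_fsupp x t : (t \in fsupp x) = (x t != 0).
Proof.
rewrite in_fset_set; last exact: (asboolW (fmvalP x)).
by apply/idP/idP; rewrite inE/=; [move=> xt; exact/eqP|move/eqP].
Qed.

Lemma fm_scaleE (a : R) y s : (a *: y) s = a * y s.
Proof. by []. Qed.

Lemma lin_ext_fbasis_inj phi x t : injective phi ->
  lin_ext (fun t => fbasis R (phi t)) x (phi t) = x t.
Proof.
move=> phi_inj; rewrite lin_extE fm_sumE.
under eq_bigr => s _ do rewrite fm_scaleE /= (inj_eq phi_inj).
by rewrite -[in RHS](lin_ext_id x) lin_extE fm_sumE.
Qed.

Lemma lin_ext_fbasis_notin phi x s : (forall t, s <> phi t) ->
  lin_ext (fun t => fbasis R (phi t)) x s = 0.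
Proof.
move=> sphi; rewrite lin_extE fm_sumE big1// => t _.
by rewrite fm_scaleE /= (negbTE (introN eqP (sphi t))) mulr0.
Qed.

Section Pullback.
Context (phi : T -> T') (phi_inj : injective phi).

Lemma fmpull_subproof y : y \o phi \in @fin_supp R T.
Proof.
apply/asboolP; have := asboolW (fmvalP y).
apply: (finite_preimage (f := phi)) => s t _ _; exact: phi_inj.
Qed.

Definition fmpull y := FreeMod (fmpull_subproof y).

Fact fmpull_is_linear : linear fmpull.
Proof. by move=> a y z; apply/fmP. Qed.

HB.instance Definition _ :=
  GRing.isLinear.Build R (freeMod R T') (freeMod R T) *:%R fmpull fmpull_is_linear.

Lemma fmpull_basis t : fmpull (fbasis R (phi t)) = fbasis R t.
Proof. by apply/fmP => s; rewrite /= (inj_eq phi_inj). Qed.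

Lemma fmpull_basis_notin s : (forall t, s <> phi t) -> fmpull (fbasis R s) = 0.
Proof.
by move=> sphi; apply/fmP => t; rewrite /= eq_sym (negbTE (introN eqP (sphi t))).
Qed.

End Pullback.
End FreeModuleEval.

(** * Vanishing in tensor products *)

Section TensorZero.
Context (S : pzRingType) (A : lmodType S^c) (M : lmodType S).
Implicit Types (x : A) (m : M).

Lemma tens_null_eq0 x m : tens x m = 0 <-> tens_null (fbasis int (x, m)).
Proof.
rewrite -[fbasis int (x, m)]subr0; apply: (iff_trans _ (iff_sym (tens_eqP _ _))).
by rewrite raddf0.
Qed.

Lemma tens_mulr x (s : S) m : tens ((s : S^c) *: x) m = tens x (s *: m).
Proof. by apply/tens_eqP/TensNullR/TensM. Qed.

Lemma tensDl x y m : tens (x + y) m = tens x m + tens y m.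
Proof.
rewrite /tens -raddfD; apply/tens_eqP; rewrite opprD addrA.
exact/TensNullR/TensDl.
Qed.

Lemma tens0r x : tens x (0 : M) = 0.
Proof.
have /tens_eqP : tens_null
    (fbasis int (x, 0 + 0 : M) - (fbasis int (x, 0) + fbasis int (x, 0))).
  by rewrite opprD addrA; exact/TensNullR/TensDr.
by rewrite addr0 raddfD => /eqP; rewrite -subr_eq0 opprD addrA subrr sub0r oppr_eq0 => /eqP.
Qed.

Lemma tens0l m : tens (0 : A) m = 0.
Proof. by rewrite -(scale0r (0 : A)) (tens_mulr 0 0) scale0r tens0r. Qed.

(** A tensor is the class of an integral combination of pairs, and null elements form a subgroup, so
    single pairs suffice. *)
Lemma tens_map_eq0 (phi : {linear A -> A}) :
  (forall x m, tens (phi x) m = 0 :> tensor A M) -> forall t : tensor A M, tens_map phi t = 0.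
Proof.
move=> phi0 t; apply: (etrans _ (raddf0 \pi_(Quotient.quot (@tens_rel _ A M))%qT)).
apply/tens_eqP; rewrite subr0; apply: asboolW.
have : repr (t : Quotient.quot (@tens_rel _ A M)) =
  lin_ext (@fbasis _ _) (repr (t : Quotient.quot (@tens_rel _ A M))).
  by rewrite lin_ext_id.
move: (repr _) => z _; rewrite lin_extE.
apply: (@rpred_sum _ (@tens_rel _ A M)) => -[x m] _ /=.
rewrite -[z _]intz scaler_int; apply: rpredMz.
by apply/asboolP/tens_null_eq0/phi0.
Qed.

End TensorZero.

(** * Coefficients over the isotropy group ring *)

Section InducedModule.
Context (R : comPzRingType) (G : topGroupoid) (u : obj G).
Local Notation RGu := (grpRing R (isot u)).
Implicit Types (a b : dfib u) (k : isot u).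

Lemma dfib_mul_inj b : injective (dfib_mul b).
Proof.
move=> k k' /(congr1 val)/= e; apply/val_inj; apply: gmulgI e.
  by rewrite dfibP (isotP k).2.
by rewrite dfibP (isotP k').2.
Qed.

Lemma rng_dfib_mul b k : rng (val (dfib_mul b k)) = rng (val b).
Proof. by rewrite /= rng_gmul// dfibP (isotP k).2. Qed.

(** Take [k = b^-1 a]. With [dfib_mul_inj], the isotropy group acts simply transitively on the
    arrows out of [u] with a given range. *)
Lemma dfib_mul_rng a b : rng (val a) = rng (val b) -> exists k, a = dfib_mul b k.
Proof.
move=> ab; have da : dom (gmul (ginv (val b)) (val a)) = u.
  by rewrite dom_gmulVl// dfibP.
have ra : rng (gmul (ginv (val b)) (val a)) = u by rewrite rng_gmulVl// dfibP.
by exists (mk_isot da ra); apply/val_inj; rewrite /= gmulVKl.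
Qed.

Lemma dfib_mulA a k k' : dfib_mul (dfib_mul a k) k' = dfib_mul a (k * k')%g.
Proof.
apply/val_inj; rewrite /= gmulA// ?dfibP ?(isotP k).1 ?(isotP k').2//.
by rewrite (isotP k).2.
Qed.

(* The coefficient of [b] in [x], the free right [RGu]-module [freeDfib] being
   spanned by any system of representatives [b] of the ranges. *)
Definition dfib_coef b (x : freeDfib R u) : RGu := fmpull (@dfib_mul_inj b) x.

Lemma dfib_coefE b x k : dfib_coef b x k = (x : freeMod R _) (dfib_mul b k).
Proof. by []. Qed.

Lemma dfib_coefD b x y : dfib_coef b (x + y) = dfib_coef b x + dfib_coef b y.
Proof. exact: raddfD. Qed.

(** By linearity [x] is a single arrow [a]. If [a = b k] then [a h = b (k h)]; otherwise neither [a]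
    nor any [a h] has the range of [b]. *)
Lemma dfib_coefZ b (s : RGu) x :
  dfib_coef b ((s : RGu^c) *: x) = dfib_coef b x * s.
Proof.
pose L (z : RGu) : RGu := lin_ext (fun k => lin_ext (fun h => fbasis R (k * h)%g) s) z.
rewrite -[RHS]/(L (dfib_coef b x)).
have pullE := lin_ext_comp (fmpull (@dfib_mul_inj b)).
rewrite -[LHS]/(fmpull (@dfib_mul_inj b) (conv (@dfib_mul G u) x s)) /conv.
have -> : dfib_coef b x = lin_ext (fmpull (@dfib_mul_inj b) \o @fbasis R _) x.
  by rewrite -pullE lin_ext_id.
rewrite pullE /L lin_ext_comp; apply: eq_lin_ext => a /=.
rewrite pullE; have [/dfib_mul_rng[k ->]|ab] := eqVneq (rng (val a)) (rng (val b)).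
  rewrite fmpull_basis lin_ext_basis; apply: eq_lin_ext => h /=.
  by rewrite dfib_mulA fmpull_basis.
rewrite fmpull_basis_notin ?raddf0 => [|k ak]; last first.
  by move/eqP: ab; apply; rewrite ak rng_dfib_mul.
rewrite lin_extE big1// => h _; rewrite /= fmpull_basis_notin ?scaler0// => k ak.
by move/eqP: ab; apply; rewrite -(rng_dfib_mul a h) ak rng_dfib_mul.
Qed.

Section Tensor.
Context (M : lmodType RGu).
Implicit Types (x : freeDfib R u) (m : M).

(** By [dfib_coefZ] the map is balanced, so it descends to the tensor product and can detect nonzero
    tensors. *)
Lemma dfib_coef_tens_null b (z : freeMod int (freeDfib R u * M)%type) :
  tens_null z -> lin_ext (fun p => dfib_coef b p.1 *: p.2 : zmodule M) z = 0.
Proof.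
elim=> [_ [x y m|x m n|x s m]||{}x y _ + _]; rewrite ?(raddfB, raddf0)/= ?lin_ext_basis/=.
- by rewrite dfib_coefD scalerDl addrAC addrK subrr.
- by rewrite scalerDr addrAC addrK subrr.
- by rewrite dfib_coefZ scalerA subrr.
- by [].
- by move=> -> ->; rewrite subrr.
Qed.

(** The converse goes by induction on the size of the support of [x], which avoids fixing a
    transversal. *)
Lemma tens_eq0 x m : tens x m = 0 <-> forall b, dfib_coef b x *: m = 0.
Proof.
split=> [/tens_null_eq0 xm b|].
  by have := dfib_coef_tens_null b xm; rewrite lin_ext_basis.
have [n] := ubnP #|` fsupp (x : freeMod R _)|.
elim: n x => // n IHn x xn xm.
have [x0|[b xb]] : (forall b, (x : freeMod R _) b = 0) \/ exists b, (x : freeMod R _) b <> 0.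
  have [?|/existsNP] := pselect (forall b, (x : freeMod R _) b = 0); by [left|right].
  have -> : x = 0 by apply/fmP.
  exact: tens0l.
(* [y] is the part of [x] on the arrows with the range of [b]. Its tensor with [m] is that of [b]
   with [dfib_coef b x *: m = 0], and removing it shrinks the support. *)
pose y : freeDfib R u := (dfib_coef b x : RGu^c) *: (fbasis R b : freeDfib R u).
have yE : y = lin_ext (fun k => fbasis R (dfib_mul b k)) (dfib_coef b x) :> freeMod R _.
  exact: lin_ext_basis.
have y_in a : rng (val a) = rng (val b) -> (y : freeMod R _) a = (x : freeMod R _) a.
  by move=> /dfib_mul_rng[k ->]; rewrite yE (lin_ext_fbasis_inj _ _ (@dfib_mul_inj b)).
have y_notin a : rng (val a) <> rng (val b) -> (y : freeMod R _) a = 0.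
  move=> ab; rewrite yE lin_ext_fbasis_notin// => k ak.
  by apply: ab; rewrite ak rng_dfib_mul.
have xyE a : (x - y : freeMod R _) a = (x : freeMod R _) a - (y : freeMod R _) a by [].
rewrite -(subrK y x) tensDl tens_mulr xm tens0r addr0; apply: IHn.
  rewrite -ltnS; apply: leq_trans xn; rewrite ltnS; apply: fproper_ltn_card.
  rewrite fproperE; apply/andP; split.
    apply/fsubsetP => a; rewrite !mem_fsupp xyE; apply: contra_neq => xa.
    have [/y_in ->|/eqP/y_notin ->] := eqVneq (rng (val a)) (rng (val b));
      by rewrite xa subrr.
  apply/fsubsetPn; exists b; rewrite mem_fsupp; first exact/eqP.
  by rewrite xyE y_in// subrr eqxx.
move=> c; have [cb|cb] := eqVneq (rng (val c)) (rng (val b)).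
  rewrite (_ : dfib_coef c _ = 0) ?scale0r//; apply/fmP => k.
  by rewrite dfib_coefE xyE y_in ?rng_dfib_mul// subrr.
rewrite -(xm c); congr (_ *: _); apply/fmP => k.
by rewrite !dfib_coefE xyE y_notin ?subr0// rng_dfib_mul; exact/eqP.
Qed.

(** Only [g = b a^-1] satisfies [g a = b]. Membership in [galg] makes the support finite, so that
    the defining sum is not 0 by convention. *)
Lemma freeDfib_act_basisE (ampleG : ample G) f a b : galg f ->
  (freeDfib_act f (fbasis R a) : freeMod R _) b =
  f (gmul (val b) (ginv (val a))).
Proof.
move=> fA; rewrite [freeDfib_act f _]lin_ext_basis.
pose A := [set g : dcomp (rng (val a)) | f (val g) <> 0].
have Afin : finite_set A.
  apply: sub_finite_set (finite_preimage (f := val) _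
    (galg_finite_dom ampleG (rng (val a)) fA)).
    by move=> g fg; split=> //; exact: (set_mem (valP g)).
  by move=> g h _ _; exact: val_inj.
have fA0 g : ~ A g -> f (val g) = 0 by move=> /contrapT.
rewrite (fsum_finite Afin) => [|g /fA0 ->]; last exact: scale0r.
rewrite fm_sumE -(fsum_finite Afin) => [|g /fA0 g0]; last by rewrite fm_scaleE g0 mul0r.
have ba : dom (gmul (val b) (ginv (val a))) = rng (val a) by rewrite dom_gmulV// !dfibP.
pose g0 : dcomp (rng (val a)) := mk_dfib ba.
have bE : b = dfib_lmul g0 by apply/val_inj; rewrite /= gmulVKr// !dfibP.
rewrite (fsum1 (i := g0)) => [|g gg0].
  by rewrite fm_scaleE/= -bE eqxx mulr1.
rewrite fm_scaleE/=; have [bg|_] := eqVneq b (dfib_lmul g); last by rewrite mulr0.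
case: gg0; apply/val_inj/(gmulIg (h := val a)).
- exact: (set_mem (valP g)).
- exact: (set_mem (valP g0)).
- by have := congr1 val bg; rewrite {1}bE => /= ->.
Qed.

(** Scalars of [R] reach a module over the group ring only through multiples of the unit. *)
Lemma grpRing_scaler (r : R) (s : RGu) : r *: s = (r *: (1 : RGu)) * s.
Proof.
rewrite -[RHS]/(conv (fun g h : isot u => (g * h)%g) (r *: (1 : RGu)) s) /conv linearZ.
congr (_ *: _); exact: (esym (mul1r s)).
Qed.

(** By [freeDfib_act_basisE], [s] is the coefficient at [b] of [f] applied to [a], and [tens_eq0]
    turns vanishing of tensors into [s *: m = 0]. *)
Lemma ann_indP (ampleG : ample G) f : ann_ind M f <-> galg f /\
  forall a b (s : RGu) m,
    (forall k, s k = f (gmul (gmul (val b) (val k)) (ginv (val a)))) -> s *: m = 0.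
Proof.
split=> -[fA f0]; split=> //.
  move=> a b s m sE; have : tens (freeDfib_act f (fbasis R a)) m = 0.
    by rewrite -tens_map_tens; exact: f0.
  move=> /tens_eq0/(_ b) <-; congr (_ *: _); apply/fmP => k.
  by rewrite dfib_coefE freeDfib_act_basisE// sE.
move=> t _; apply: tens_map_eq0 => x m; apply/tens_eq0 => b.
have -> : dfib_coef b (freeDfib_act f x) =
    lin_ext (fun a => dfib_coef b (freeDfib_act f (fbasis R a))) (x : freeMod R _).
  apply: (etrans (lin_ext_comp (fmpull (@dfib_mul_inj b)) _ _)).
  by apply: eq_lin_ext => a; rewrite [freeDfib_act f _]lin_ext_basis.
rewrite lin_extE scaler_suml big1// => a _; rewrite grpRing_scaler -scalerA.
rewrite (f0 a b (dfib_coef b _)) ?scaler0// => k.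
by rewrite dfib_coefE freeDfib_act_basisE.
Qed.

End Tensor.

End InducedModule.

(** * Annihilators of modules of sections *)

(** Finitely many fibres of [key] meet the support, so the total is a finite sum of vanishing fibre
    sums. *)
Lemma fsum_fibres (V : nmodType) (I K : choiceType) (key : I -> K) (F : I -> V) :
  finite_set [set i | F i <> 0] ->
  (forall i, \sum_(j \in [set j | key j = key i]) F j = 0) ->
  \sum_(i \in [set: I]) F i = 0.
Proof.
move=> Ffin F0; rewrite (fsum_finite Ffin); last by move=> i /contrapT.
rewrite (partition_big_imfset _ key) big_seq big1// => _ /imfsetP[i _ ->].
apply: etrans (F0 i); rewrite fsbig_mkcond (fsum_finite Ffin) => [|j /contrapT]; last first.
  by rewrite /patch => ->; case: ifP.
rewrite big_mkcond; apply: eq_bigr => j _; rewrite /patch.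
by have [e|/eqP e] := eqVneq; [rewrite mem_set|rewrite memNset].
Qed.

Section SheafSections.
Context (R : comPzRingType) (G : topGroupoid) (ampleG : ample G).
Context (E : gsheafMod R G).

(** A local section through [e] over a compact open [V] is extended by zero. Being compact in a
    Hausdorff space, [V] is also closed, so the extension is continuous. *)
Lemma gammac_through (e : tot E) (N : set (obj G)) : open N -> N (pr e) ->
  exists s : forall u, stalk E u,
    [/\ gammac s, val (s (pr e)) = e & forall x, ~ N x -> s x = 0].
Proof.
move=> No Ne; have [_ Gh _ _] := ampleG.
have [U [g [Uo Ue gK gc /(_ setT openT)]]] := local_homeoP e (@pr_local_homeo _ E).
rewrite setIT; set O := @pr _ E @` U => Oo.
have [|V [Vo [Vc Vh] Ve VON]] := ample_basis ampleG (openI Oo No) (u := pr e).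
  by split=> //; exists e.
have Vcl := compact_closed Gh Vc.
have prg x : V x -> U (g x) /\ pr (g x) = x.
  by move=> /VON[[z Uz <-] _]; rewrite gK ?inE.
pose s x : stalk E x := match pselect (V x) with
  | left Vx => mk_stalk (prg x Vx).2 | right _ => 0 end.
have s_in x : V x -> val (s x) = g x by rewrite /s; case: pselect.
have s_out x : ~ V x -> s x = 0 by rewrite /s; case: pselect.
(* [U] meets each stalk in at most one point, so over [V] the section vanishes exactly where the
   zero section enters [U]. This is an open condition, so the support is closed in [V]. *)
have s0 x : V x -> (s x = 0) <-> U (szero E x).
  move=> Vx; split=> [sx0|Ux].
    by have := s_in x Vx; rewrite sx0/= => ->; exact: (prg x Vx).1.
  by apply/val_inj; rewrite s_in//= -{1}(pr_szero E x) gK ?inE.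
exists s; split; last 2 first.
- by rewrite s_in// gK ?inE.
- by move=> x nNx; apply: s_out => /VON[].
split.
  apply/continuousP => W Wo.
  rewrite (_ : _ @^-1` _ = (V `&` (O `&` g @^-1` W)) `|` (~` V `&` szero E @^-1` W)).
    apply: openU; apply: openI => //.
    - exact: open_within_preimage.
    - exact: closed_openC.
    - exact: open_preimage (@continuous_szero _ _ E) Wo.
  apply/seteqP; split=> [x /= Wx|x [[Vx [_ Wx]]|[nVx Wx]]] /=.
  - have [Vx|nVx] := pselect (V x); [left|right].
      by rewrite -s_in//; split=> //; split=> //; case: (VON x Vx).
    by split=> //=; move: Wx; rewrite s_out.
  - by rewrite s_in.
  - by rewrite s_out.
have -> : [set u | s u <> 0] = V `&` ~` (szero E @^-1` U).
  apply/seteqP; split=> x /=.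
    move=> sx; have Vx : V x by apply: contrapT => /s_out.
    by split=> // /s0-/(_ Vx).
  by move=> [Vx nUx] /s0-/(_ Vx).
split.
  apply: compact_closedI => //; apply: open_closedC.
  exact: open_preimage (@continuous_szero _ _ E) Uo.
by apply: (hausdorff_sub (f := id)) Gh _ _ => // x; exact: cvg_id.
Qed.

Section InducedStalk.
Context (f : arr G -> R) (u : obj G) (a b : dfib u) (s0 : grpRing R (isot u)).
Hypothesis s0E :
  forall k, s0 k = f (gmul (gmul (val b) (val k)) (ginv (val a))).

(** The arrows [g : v -> w] are the [b k a^-1], each for exactly one [k], and [s v = a m] gives
    [g (s v) = b k m]. *)
Lemma stalk_act_coef v w (ra : rng (val a) = v) (rb : rng (val b) = w)
    (m : stalkG E u) (s : forall v, stalk E v) :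
  s v = stalk_act (dfibP a) ra m ->
  stalk_act (dfibP b) rb (s0 *: m : stalkG E u) =
  \sum_(g \in [set g : rfib w | dom (val g) = v])
    f (val g) *: stalk_act erefl (set_mem (valP g)) (s (dom (val g))).
Proof.
move=> sa; pose h0 (k : isot u) := gmul (gmul (val b) (val k)) (ginv (val a)).
have bk (k : isot u) : dom (val b) = rng (val k) by rewrite dfibP (isotP k).2.
have bka (k : isot u) : dom (gmul (val b) (val k)) = dom (val a).
  by rewrite dom_gmul// dfibP (isotP k).1.
have rh k : rng (h0 k) = w by rewrite rng_gmulV// rng_gmul.
have dh k : dom (h0 k) = v by rewrite dom_gmulV.
pose h k : rfib w := exist _ (h0 k) (mem_set (rh k)).
have hinj : injective h.
  move=> k k' /(congr1 val)/= /gmulIg e; apply/val_inj/(gmulgI (bk k) (bk k')).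
  by apply: e; rewrite rng_ginv.
have -> : [set g : rfib w | dom (val g) = v] = h @` setT.
  apply/seteqP; split=> [g /= ga|_ [k _ <-]]; last exact: dh.
  have rg : rng (val g) = w by exact: (set_mem (valP g)).
  have dga : dom (gmul (val g) (val a)) = u by rewrite dom_gmul ?ra// dfibP.
  have [|k gak] := @dfib_mul_rng _ u (mk_dfib dga) b; first by rewrite /= rng_gmul ?ra// rb.
  exists k => //; apply/val_inj; rewrite /= /h0.
  by move: (congr1 val gak) => /= <-; rewrite gmulKr ?ra.
rewrite fsbig_image; last by move=> k k' _ _; exact: hinj.
apply: (etrans (lin_ext_comp (stalk_act (dfibP b) rb) _ _)).
apply: eq_fsbigr => k _ /=; rewrite s0E; congr (_ *: _); apply/val_inj => /=.
have -> : val (s (dom (h0 k))) = sact (val a) (val m).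
  by rewrite -[RHS]/(val (stalk_act (dfibP a) ra m)) -sa dh.
rewrite !sactM ?stalkP ?dfibP ?(isotP k).1 ?(isotP k).2 ?dh ?ra//.
by rewrite gmulVKr.
Qed.

End InducedStalk.

Lemma gammac_act_support (f : arr G -> R) (s : forall v, stalk E v) w : galg f ->
  finite_set [set g : rfib w |
    f (val g) *: stalk_act erefl (set_mem (valP g)) (s (dom (val g))) <> 0].
Proof.
move=> fA; apply: sub_finite_set (finite_preimage (f := val) _
    (galg_finite_rng ampleG w fA)).
  move=> g /= fg0; split; first exact: (set_mem (valP g)).
  by move=> fg; apply: fg0; rewrite fg scale0r.
by move=> g h _ _; exact: val_inj.
Qed.

Lemma sact_idm_stalk v (e : stalk E v) : sact (idm v) (val e) = val e.
Proof. by have := sact_idm (val e); rewrite stalkP. Qed.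

Lemma stalk_act_eq0 v w g (dg : dom g = v) (rg : rng g = w) (e : stalk E v) :
  stalk_act dg rg e = 0 -> e = 0.
Proof.
move=> ge; have ri : rng (ginv g) = v by rewrite rng_ginv.
have di : dom (ginv g) = w by rewrite dom_ginv.
rewrite -[RHS](raddf0 (stalk_act di ri)) -ge; apply/val_inj => /=.
by rewrite sactM ?stalkP ?dom_ginv// gmulVg dg sact_idm_stalk.
Qed.

(** Without objects the intersection imposes nothing, but then there are no arrows either and [f] is
    an empty sum. *)
Lemma bigcap_ann_galg (J : obj G -> set (arr G -> R)) f :
  (forall u, J u `<=` @galg R G) -> (\bigcap_(u in [set: obj G]) J u) f -> galg f.
Proof.
move=> JA fJ; have [[u _]|/set0P/negP/negPn/eqP obj0] := pselect ([set: obj G] !=set0).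
  exact: JA (fJ u I).
exists 0%N, (fun=> 0), (fun=> set0); split=> [[]//|].
apply/funext => g; have : [set: obj G] (dom g) by [].
by rewrite obj0.
Qed.

Lemma ann_gammacE : ann_gammac E = \bigcap_(u in [set: obj G]) ann_ind (stalkG E u).
Proof.
have [_ Gh _ _] := ampleG.
apply/seteqP; split=> [f [fA f0] u _|f fI].
  apply/(ann_indP _ ampleG); split=> // a b s0 m s0E.
  set v := rng (val a); set w := rng (val b).
  (* These are the finitely many unwanted domains; a section vanishing on [D] leaves only the terms
     with domain [v]. *)
  pose D := @dom G @` [set g | rng g = w /\ f g <> 0] `\ v.
  have Do : open (~` D).
    apply: closed_openC; apply: (accessible_finite_set_closed.1 (hausdorff_accessible Gh)).
    exact/finite_setD/finite_image/galg_finite_rng.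
  have pe : pr (sact (val a) (val m)) = v by rewrite pr_sact ?stalkP ?dfibP.
  have [|s [sc sa sD]] := gammac_through (e := sact (val a) (val m)) Do.
    by rewrite pe => -[_]; apply.
  have {}sa : s v = stalk_act (dfibP a) erefl m.
    by apply/val_inj; rewrite -[RHS]sa pe.
  (* Acting by [b] is injective, and [b (s0 m)] is the value at [w] of [f] applied to [s]. *)
  apply: (stalk_act_eq0 (dg := dfibP b) (rg := erefl)).
  rewrite (stalk_act_coef s0E erefl sa) (fsbig_widen _ setT) => [|//|g [_ /= gv]].
    by have := congr1 (fun F => F w) (f0 s sc).
  have [->|fg] := eqVneq (f (val g)) 0; first exact: scale0r.
  rewrite sD ?raddf0 ?scaler0// => nD; apply: nD; split=> //.
  exists (val g) => //; split; first exact: (set_mem (valP g)).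
  exact/eqP.
have fA : galg f by apply: bigcap_ann_galg fI => u ? [].
split=> // s _; apply: functional_extensionality_dep => w.
apply: (fsum_fibres (key := fun g : rfib w => dom (val g))).
  exact: gammac_act_support.
move=> g0; have rg0 : rng (val g0) = w by exact: (set_mem (valP g0)).
(* The module induced from [w] suffices: take [a = g0^-1], [b] the identity at [w] and
   [m = g0 s(v)], where [v] is the domain of [g0], so that [a m = s(v)]. *)
have da : dom (ginv (val g0)) = w by rewrite dom_ginv.
have ra : rng (ginv (val g0)) = dom (val g0) by rewrite rng_ginv.
pose a : dfib w := mk_dfib da; pose b : dfib w := mk_dfib (dom_idm w).
rewrite -(stalk_act_coef (a := a) (b := b)
  (s0 := dfib_coef b (freeDfib_act f (fbasis R a)))
  (ra := ra) _ (rng_idm w) (m := stalk_act erefl rg0 (s (dom (val g0))))).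
- have /(ann_indP _ ampleG)[_ f0] := fI w I; rewrite (f0 a b); first exact: raddf0.
  by move=> k; rewrite dfib_coefE freeDfib_act_basisE.
- by move=> k; rewrite dfib_coefE freeDfib_act_basisE.
- apply/val_inj; rewrite /= sactM ?stalkP ?dom_ginv// gmulVg.
  by rewrite sact_idm_stalk.
Qed.

End SheafSections.

(** * Ideals of the groupoid algebra *)

Section QuotientModule.
Context (S : pzRingType) (V : lmodType S) (N : {pred V}).
Context (Nsub : submod_closed N).

(** The closure proof is an argument so that the instances on the quotient can be inferred. *)
Definition subm_of of submod_closed N : {pred V} := N.

Local Notation P := (subm_of Nsub).

HB.instance Definition _ := GRing.isZmodClosed.Build V P (GRing.submod_closedB Nsub).

Lemma subm_scaler s x : x \in P -> s *: x \in P.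
Proof. by have [N0 Nlin] := Nsub => xN; rewrite -[_ *: _]addr0; exact: Nlin. Qed.

Definition quotMod : Type := Quotient.quot P.

HB.instance Definition _ := GRing.Zmodule.on quotMod.

Definition quotpi (x : V) : quotMod := \pi_(Quotient.quot P)%qT x.

Lemma quotpi_eqP x y : quotpi x = quotpi y <-> x - y \in P.
Proof. by rewrite Quotient.idealrBE; split=> [xy|/eqP//]; exact/eqP. Qed.

Lemma quotpi_eq0 x : quotpi x = 0 <-> x \in P.
Proof. by rewrite -{2}(subr0 x) -quotpi_eqP [quotpi 0]raddf0. Qed.

Lemma quotpiD : {morph quotpi : x y / x + y}.
Proof. exact: (raddfD \pi_(Quotient.quot P)%qT). Qed.

Lemma quotpi_surj (q : quotMod) : exists x, q = quotpi x.
Proof. by exists (repr (q : Quotient.quot P)); rewrite /quotpi reprK. Qed.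

Definition quot_scale (s : S) (q : quotMod) : quotMod :=
  quotpi (s *: repr (q : Quotient.quot P)).

Lemma quot_scale_pi s x : quot_scale s (quotpi x) = quotpi (s *: x).
Proof.
apply/quotpi_eqP; rewrite -scalerBr; apply: subm_scaler.
by apply/quotpi_eqP; rewrite /quotpi reprK.
Qed.

Fact quot_scaleA s t q : quot_scale s (quot_scale t q) = quot_scale (s * t) q.
Proof. by have [x ->] := quotpi_surj q; rewrite !quot_scale_pi scalerA. Qed.

Fact quot_scale1 : left_id 1 quot_scale.
Proof. by move=> q; have [x ->] := quotpi_surj q; rewrite quot_scale_pi scale1r. Qed.

Fact quot_scaleDr : right_distributive quot_scale +%R.
Proof.
move=> s p q; have [[x ->] [y ->]] := (quotpi_surj p, quotpi_surj q).
by rewrite -quotpiD !quot_scale_pi scalerDr quotpiD.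
Qed.

Fact quot_scaleDl q : {morph quot_scale^~ q : s t / s + t}.
Proof.
by move=> s t; have [x ->] := quotpi_surj q; rewrite !quot_scale_pi scalerDl quotpiD.
Qed.

HB.instance Definition _ := GRing.Zmodule_isLmodule.Build S quotMod
  quot_scaleA quot_scale1 quot_scaleDr quot_scaleDl.

Lemma quotpiZ s x : s *: quotpi x = quotpi (s *: x).
Proof. exact: quot_scale_pi. Qed.

End QuotientModule.

(** * The free left module on a range fibre *)

Section RangeFibre.
Context (R : comPzRingType) (G : topGroupoid) (u : obj G).
Local Notation RGu := (grpRing R (isot u)).

Lemma rfibP (c : rfib u) : rng (val c) = u.
Proof. exact: set_mem (valP c). Qed.

Definition mk_rfib g (gu : rng g = u) : rfib u := exist _ g (mem_set gu).

Fact rfib_mul_subproof (k : isot u) (c : rfib u) : rng (gmul (val k) (val c)) = u.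
Proof. by rewrite rng_gmul ?rfibP ?(isotP k).1 ?(isotP k).2. Qed.

Definition rfib_mul k c : rfib u := mk_rfib (rfib_mul_subproof k c).

Lemma rfib_mul_injr k : injective (rfib_mul k).
Proof.
move=> c c' /(congr1 val) /= e; apply/val_inj.
by apply: gmulgI e; rewrite rfibP (isotP k).1.
Qed.

Lemma rfib_mul_injl c : injective (rfib_mul^~ c).
Proof.
move=> k k' /(congr1 val) /= e; apply/val_inj.
by apply: gmulIg e; rewrite rfibP (isotP _).1.
Qed.

Definition freeRfib : Type := freeMod R (rfib u).

HB.instance Definition _ := GRing.Zmodule.on freeRfib.

Definition freeRfib_scale (s : RGu) (x : freeRfib) : freeRfib := conv rfib_mul s x.

Fact freeRfib_scaleA s t x :
  freeRfib_scale s (freeRfib_scale t x) = freeRfib_scale (s * t) x.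
Proof.
apply: esym; apply: convA => k h c; apply/val_inj => /=.
by rewrite gmulA ?rfibP ?(isotP k).1 ?(isotP h).1 ?(isotP h).2.
Qed.

Fact freeRfib_scale1 : left_id 1 freeRfib_scale.
Proof.
move=> x; apply: conv1l => c; apply/val_inj.
by have := gmul1g (val c); rewrite rfibP.
Qed.

Fact freeRfib_scaleDr : right_distributive freeRfib_scale +%R.
Proof. by move=> s x y; exact: convDr. Qed.

Fact freeRfib_scaleDl x : {morph freeRfib_scale^~ x : s t / s + t}.
Proof. by move=> s t; exact: convDl. Qed.

HB.instance Definition _ := GRing.Zmodule_isLmodule.Build RGu freeRfib
  freeRfib_scaleA freeRfib_scale1 freeRfib_scaleDr freeRfib_scaleDl.

End RangeFibre.

Section Ideal.
Context (R : comPzRingType) (G : topGroupoid) (ampleG : ample G).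
Context (I : set (arr G -> R)) (Iideal : galg_ideal I).
Implicit Types (f h : arr G -> R).

Lemma idealD f h : I f -> I h -> I (f + h).
Proof.
have [_ I0 IB _] := Iideal => If Ih.
by rewrite -[h]opprK -[- h]add0r; exact: IB If (IB _ _ I0 Ih).
Qed.

Lemma ideal_sum (J : Type) (r : seq J) (F : J -> arr G -> R) :
  (forall j, I (F j)) -> I (\sum_(j <- r) F j).
Proof.
by move=> IF; elim/big_ind: _ => //; [case: Iideal|exact: idealD].
Qed.

Section Fibre.
Variable u : obj G.
Local Notation RGu := (grpRing R (isot u)).

(* A function of the algebra that vanishes on the range fibre of [u] vanishes
   over a neighbourhood of [u] (galg_germ0): so [freeRfib R u] is the stalk of the
   algebra at [u], and [ideal_stalk] that of the ideal. *)
Definition ideal_stalk : {pred freeRfib R u} :=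
  fun x => `[< exists2 f, I f & forall c : rfib u, (x : freeMod R _) c = f (val c) >].

(** A bisection [B] through [k] has no other arrow with range [u], so convolution with [r * \1_B]
    acts on the range fibre as [r k]. *)
Lemma ideal_stalk_lmul (r : R) (k : isot u) (x : freeMod R (rfib u)) :
  x \in ideal_stalk ->
  r *: lin_ext (fun c => fbasis R (rfib_mul k c)) x \in ideal_stalk.
Proof.
move=> /asboolP[f If xf]; apply/asboolP.
have [B [Bb Bk _]] := bisection_basis ampleG openT (Logic.I : [set: arr G] (val k)).
have [_ _ _ Iconv] := Iideal; have [_ _ _ Binj] := Bb.
exists (gconv (fun g => r * \1_B g) f).
  by apply: (Iconv _ _ If (galg_scale_indic r Bb)).1.
move=> c; have rkc : rng (val k) = rng (val c) by rewrite (isotP k).2 rfibP.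
rewrite (gconv_bisl _ _ Binj Bk)//.
have rc : rng (gmul (ginv (val k)) (val c)) = u by rewrite rng_gmulVl// (isotP k).1.
have cE : c = rfib_mul k (mk_rfib rc) by apply/val_inj; rewrite /= gmulVKl.
rewrite {1}cE fm_scaleE (lin_ext_fbasis_inj _ _ (@rfib_mul_injr _ u k)).
by rewrite xf.
Qed.

Lemma ideal_stalkD (x y : freeRfib R u) :
  x \in ideal_stalk -> y \in ideal_stalk -> x + y \in ideal_stalk.
Proof.
move=> /asboolP[f If xf] /asboolP[h Ih yh]; apply/asboolP.
exists (f + h); first exact: idealD.
by move=> c; rewrite -[RHS]/(f _ + h _) -xf -yh.
Qed.

Lemma ideal_stalk0 : 0 \in ideal_stalk.
Proof. by apply/asboolP; exists 0 => //; case: Iideal. Qed.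

Lemma ideal_stalk_submod : submod_closed ideal_stalk.
Proof.
split=> [|s x y xI yI]; first exact: ideal_stalk0.
apply: ideal_stalkD => //; rewrite -[s *: x]/(conv (@rfib_mul _ u) s x) /conv lin_extE.
elim/big_ind: _ => [|y1 y2|k _]; [exact: ideal_stalk0|exact: ideal_stalkD|].
exact: ideal_stalk_lmul.
Qed.

Definition ideal_quot : lmodType RGu := quotMod ideal_stalk_submod.

Lemma freeRfib_scale_basis (s : RGu) (c : rfib u) :
  s *: (fbasis R c : freeRfib R u) = 
    lin_ext (fun k => fbasis R (rfib_mul k c)) s :> freeMod R (rfib u).
Proof.
rewrite -[LHS]/(conv (@rfib_mul _ u) s (fbasis R c)) /conv.
by apply: eq_lin_ext => k; rewrite lin_ext_basis.
Qed.

Lemma rfib_mul_dom (c d : rfib u) : dom (val d) = dom (val c) -> exists k, d = rfib_mul k c.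
Proof.
move=> dc; have dk : dom (gmul (val d) (ginv (val c))) = u by rewrite dom_gmulV// rfibP.
have rk : rng (gmul (val d) (ginv (val c))) = u by rewrite rng_gmulV// rfibP.
by exists (mk_isot dk rk); apply/val_inj; rewrite /= gmulVKr.
Qed.

Lemma freeRfib_scale_basis_notin (s : RGu) (c d : rfib u) : dom (val d) <> dom (val c) ->
  (s *: (fbasis R c : freeRfib R u) : freeMod R _) d = 0.
Proof.
move=> dc; rewrite freeRfib_scale_basis lin_ext_fbasis_notin// => k dk.
by apply: dc; rewrite dk /= dom_gmul// rfibP (isotP k).1.
Qed.

Lemma freeRfib_scale_basisE (s : RGu) (c : rfib u) k :
  (s *: (fbasis R c : freeRfib R u) : freeMod R _) (rfib_mul k c) = s k.
Proof.
by rewrite freeRfib_scale_basis (lin_ext_fbasis_inj _ _ (@rfib_mul_injl _ u c)).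
Qed.

(** On the range fibre of [u], this element agrees with the product of [r * \1_B], [f] and [\1_D],
    for bisections [B] through [b^-1] and [D] through [e = a c]. *)
Lemma ideal_stalk_transport f (a b : dfib u) (s : RGu) (c : rfib u) (r : R) : I f ->
  (forall k, s k = f (gmul (gmul (val b) (val k)) (ginv (val a)))) ->
  r *: (s *: (fbasis R c : freeRfib R u) : freeMod R _) \in ideal_stalk.
Proof.
move=> If sE; have [_ Gh _ _] := ampleG; have [IA _ _ Iconv] := Iideal.
pose e := gmul (val a) (val c).
have ac : dom (val a) = rng (val c) by rewrite dfibP rfibP.
(* Ranges of arrows of [D] are kept off [Z], so that those other than [e] only bring in zero values
   of [f]. *)
pose Z := @dom G @` [set g | rng g = rng (val b) /\ f g <> 0] `\ rng e.
have No : open (@rng G @^-1` (~` Z)).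
  apply: open_preimage (@continuous_rng G) _; apply: closed_openC.
  apply: (accessible_finite_set_closed.1 (hausdorff_accessible Gh)).
  exact/finite_setD/finite_image/galg_finite_rng/IA.
have [|D [Db De DZ]] := bisection_basis ampleG No (g := e); first by move=> [_]; apply.
have [B [Bb Bbi _]] := bisection_basis ampleG openT (Logic.I : [set: arr G] (ginv (val b))).
have [[_ _ _ Binj] [_ _ Ddom Drng]] := (Bb, Db).
have BE g : rng g = u -> gconv (fun g => r * \1_B g) f g = r * f (gmul (val b) g).
  by move=> gu; rewrite (gconv_bisl _ _ Binj Bbi) ?ginvK// rng_ginv dfibP gu.
apply/asboolP; exists (gconv (gconv (fun g => r * \1_B g) f) \1_D).
  apply: (Iconv _ _ _ (galg_indic R Db)).2.
  exact: (Iconv _ _ If (galg_scale_indic r Bb)).1.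
move=> d; have [dc|dc] := eqVneq (dom (val d)) (dom (val c)).
  have [k dE] := rfib_mul_dom dc.
  have ed : dom e = dom (val d) by rewrite dc dom_gmul.
  rewrite (gconv_bisr _ Ddom De ed) BE; last by rewrite rng_gmulV// rfibP.
  rewrite {1}dE fm_scaleE freeRfib_scale_basisE sE -gmulA; first last.
  - by rewrite rng_ginv (isotP k).1 dfibP.
  - by rewrite dfibP (isotP k).2.
  congr (r * f (gmul _ _)).
  (* Multiplied by [e = a c] on the right, [k a^-1 = d e^-1] becomes [k c = d]. *)
  apply: (gmulIg (h := e)).
  - by rewrite dom_gmulV ?rng_gmul// (isotP k).1 dfibP.
  - by rewrite dom_gmulV.
  rewrite gmulVKr// dE /= /e gmulA ?dom_gmulV ?(isotP k).1 ?dfibP ?rfibP//.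
  by rewrite gmulVKr// (isotP k).1 dfibP.
rewrite fm_scaleE freeRfib_scale_basis_notin ?mulr0; last exact/eqP.
have [[d' Dd' d'd]|nD] := pselect (exists2 d', D d' & dom d' = dom (val d)); last first.
  by rewrite gconv_bisr0// => d' Dd' d'd; apply: nD; exists d'.
rewrite (gconv_bisr _ Ddom Dd' d'd) BE; last by rewrite rng_gmulV// rfibP.
rewrite [f _](_ : _ = 0) ?mulr0//; apply: contrapT => fg.
have rd : rng (gmul (val d) (ginv d')) = u by rewrite rng_gmulV// rfibP.
apply: (DZ d' Dd'); split.
  exists (gmul (val b) (gmul (val d) (ginv d'))); first split=> //.
    by rewrite rng_gmul// dfibP rd.
  by rewrite dom_gmul ?dom_gmulV// dfibP rd.
move=> /= d'e; case/eqP: dc; rewrite -d'd (Drng d' e) ?mem_set//.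
by rewrite dom_gmul.
Qed.

Lemma ideal_sub_ann : I `<=` ann_ind ideal_quot.
Proof.
move=> f If; apply/(ann_indP _ ampleG); split; first by case: Iideal => IA _ _ _; exact: IA.
move=> a b s q sE; have [x ->] := quotpi_surj q.
apply: (etrans (quotpiZ _ _ _)); apply/quotpi_eq0.
rewrite -[x]lin_ext_id lin_extE.
have -> : s *: (\sum_(c <- fsupp x) x c *: fbasis R c : freeRfib R u) =
    \sum_(c <- fsupp x) x c *: (s *: (fbasis R c : freeRfib R u) : freeMod R _).
  apply: (etrans (raddf_sum (conv (@rfib_mul _ u) s) _ _ _)).
  by apply: eq_bigr => c _; exact: linearZ.
elim/big_ind: _ => [|y1 y2|c _]; [exact: ideal_stalk0|exact: ideal_stalkD|].
exact: ideal_stalk_transport If sE.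
Qed.

(** With [a = c^-1] and [b] an identity, [s] applied to [c] has coefficient [f d] at each [d] with
    the domain of [c], and 0 elsewhere. Its class in the quotient is zero, so an element of [I]
    restricts to it. *)
Lemma ann_fibre_dom f (v : obj G) : ann_ind ideal_quot f ->
  exists2 f', I f' & forall c : rfib u,
    f' (val c) = if dom (val c) == v then f (val c) else 0.
Proof.
move=> /(ann_indP _ ampleG)[fA f0].
have [[c cv]|nc] := pselect (exists c : rfib u, dom (val c) = v); last first.
  exists 0; first by case: Iideal.
  by move=> c; case: eqP => // cv; case: nc; exists c.
have da : dom (ginv (val c)) = u by rewrite dom_ginv rfibP.
pose a : dfib u := mk_dfib da; pose b : dfib u := mk_dfib (dom_idm u).
pose s : RGu := dfib_coef b (freeDfib_act f (fbasis R a)).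
have sE k : s k = f (gmul (gmul (val b) (val k)) (ginv (val a))).
  by rewrite dfib_coefE freeDfib_act_basisE.
have /quotpi_eq0/asboolP[f' If' f'E] :
    quotpi ideal_stalk_submod (s *: (fbasis R c : freeRfib R u)) = 0.
  by rewrite -quotpiZ; exact: f0 sE.
exists f' => // d; rewrite -f'E; case: eqP => [dv|dv].
  have [|k dE] := @rfib_mul_dom c d; first by rewrite dv cv.
  rewrite {1}dE freeRfib_scale_basisE sE/= ginvK dE/=; congr (f (gmul _ _)).
  by have := gmul1g (val k); rewrite (isotP k).2.
by rewrite freeRfib_scale_basis_notin// cv.
Qed.

(** Finitely many domains occur where [f] is nonzero on the range fibre; the elements given by
    [ann_fibre_dom] are added over them. *)
Lemma ann_fibre f : ann_ind ideal_quot f ->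
  exists2 f', I f' & forall g, rng g = u -> f' g = f g.
Proof.
move=> fI; have /choice[F FP] v : exists f', I f' /\ forall c : rfib u,
    f' (val c) = if dom (val c) == v then f (val c) else 0.
  by have [f' If' f'E] := ann_fibre_dom v fI; exists f'.
pose X := fset_set (@dom G @` [set g | rng g = u /\ f g <> 0]).
exists (\sum_(v <- X) F v); first by apply: ideal_sum => v; have [] := FP v.
have XP v : (v \in X) = (v \in @dom G @` [set g | rng g = u /\ f g <> 0]).
  by rewrite in_fset_set//; apply/finite_image/galg_finite_rng; case: fI.
move=> g gu; have FE v : F v g = if dom g == v then f g else 0.
  exact: (FP v).2 (mk_rfib gu).
rewrite fct_sumE; have [gX|/negP gX] := boolP (dom g \in X).
  rewrite (bigD1_seq (dom g)) ?fset_uniq//= FE eqxx big1 ?addr0// => v vg.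
  by rewrite FE eq_sym (negbTE vg).
have f0 : f g = 0.
  by apply: contrapT => fg; apply: gX; rewrite XP inE; exists g.
by rewrite f0 big1// => v _; rewrite FE f0 if_same.
Qed.

End Fibre.
Definition cut (U : set (obj G)) f : arr G -> R :=
  fun g => if rng g \in U then f g else 0.

(** By [unit_nbhs] some bisection around [idm w] consists of identities; [cut U] is left convolution
    with its characteristic function. *)
Lemma local_unit (w : obj G) (N : set (obj G)) : open N -> N w ->
  exists U, [/\ open U, U w, U `<=` N & forall f, I f -> I (cut U f)].
Proof.
move=> No Nw; have [N' [N'o N'w N'1]] := unit_nbhs ampleG w.
have [|B [Bb Bw BN]] := bisection_basis ampleG (g := idm w)
    (openI N'o (open_preimage (@continuous_rng G) No)).
  by split=> //=; rewrite rng_idm.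
have [_ _ _ Iconv] := Iideal; have [Bo _ _ Binj] := Bb.
have B1 v : B v -> v = idm (dom v) by move=> /BN[/N'1].
exists (@idm G @^-1` B); split=> //.
- exact: open_preimage (@continuous_idm G) Bo.
- by move=> v /BN[_ /=]; rewrite rng_idm.
move=> f If; rewrite (_ : cut _ _ = gconv (fun g => 1 * \1_B g) f); last first.
  apply/funext => g; rewrite /cut; case: ifPn => [/set_mem Bg|/negP nBg].
    rewrite (gconv_bisl _ _ Binj Bg) ?rng_idm// mul1r.
    by have := gmulKl (dom_idm (rng g)); rewrite gmul1g => ->.
  rewrite gconv_bisl0// => b Bb' bg; apply: nBg; rewrite inE/= -bg.
  by rewrite (B1 b Bb') rng_idm -(B1 b Bb').
exact: (Iconv _ _ If (galg_scale_indic 1 Bb)).1.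
Qed.

(** By [galg_germ0], [f] agrees near [w] with an element of [I]. Stability of [I] under [cut U] is
    recorded for the gluing. *)
Lemma ann_germ f (w : obj G) : ann_ind (ideal_quot w) f ->
  exists U, [/\ open U, U w, forall h, I h -> I (cut U h) & I (cut U f)].
Proof.
move=> fI; have [fA _] := fI; have [f' If' f'E] := ann_fibre fI.
have [IA _ _ _] := Iideal.
have [|N [No Nw NE]] := galg_germ0 ampleG (u := w) (galgB fA (IA _ If')).
  by move=> g gw; rewrite -[LHS]/(f g - f' g) f'E// subrr.
have [U [Uo Uw UN UI]] := local_unit No Nw.
exists U; split=> //; rewrite (_ : cut U f = cut U f'); first exact: UI.
apply/funext => g; rewrite /cut; case: ifP => // /set_mem /UN /NE fg.
by apply/eqP; rewrite -subr_eq0; apply/eqP.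
Qed.

Lemma ideal_eq_ann : I = \bigcap_(u in [set: obj G]) ann_ind (ideal_quot u).
Proof.
apply/seteqP; split=> [f If u _|f fI]; first exact: ideal_sub_ann.
have fA : galg f by apply: bigcap_ann_galg fI => u ? [].
have [K Kc fK] := galg_support fA.
have /choice[U UP] w := ann_germ (fI w Logic.I).
have rKc : compact (@rng G @` K).
  by apply: continuous_compact Kc; apply: continuous_subspaceT; exact: continuous_rng.
have [w|r rK] := compact_finite_cover (V := U) rKc; first by have [] := UP w.
(* The chosen sets cover the ranges of the arrows where [f] is nonzero, so cutting to their union
   leaves [f] unchanged. *)
have -> : f = cut [set v | exists2 w, w \in r & U w v] f.
  apply/funext => g; rewrite /cut; case: ifPn => // /negP nU.
  apply: contrapT => fg; apply: nU; rewrite inE; apply: rK.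
  by exists g => //; exact: fK.
elim: r {rK} => [|w r IHr].
  rewrite (_ : cut _ f = 0); first by case: Iideal.
  apply/funext => g; rewrite /cut; case: ifP => // /set_mem[w].
  by rewrite in_nil.
have [_ I0 IB _] := Iideal; have [_ _ UI Uf] := UP w.
set A := [set v | exists2 w, w \in r & U w v] in IHr.
(* The overlap of [U w] and [A] would be counted twice; the subtracted term stays in [I] because
   [cut (U w)] preserves [I]. *)
rewrite (_ : cut _ f = cut (U w) f + (cut A f - cut (U w) (cut A f))).
  by apply: idealD => //; apply: IB => //; exact: UI.
apply/funext => g.
rewrite -[RHS]/(cut (U w) f g + (cut A f g - cut (U w) (cut A f) g)) /cut.
have -> : [set v | exists2 w', w' \in w :: r & U w' v] = U w `|` A.
  apply/seteqP; split=> v /= [].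
  - by move=> w'; rewrite inE => /orP[/eqP ->|w'r] Uv; [left|right; exists w'].
  - by move=> Uv; exists w => //; rewrite inE eqxx.
  - by move=> [w' w'r Uv]; exists w' => //; rewrite inE w'r orbT.
rewrite in_setU; case: (rng g \in U w) => /=; first by rewrite subrr addr0.
by rewrite add0r subr0.
Qed.

End Ideal.

Theorem theorem5 (R : comPzRingType) (G : topGroupoid) (ampleG : ample G) :
  (forall E : gsheafMod R G,
     ann_gammac E = \bigcap_(u in [set: obj G]) ann_ind (stalkG E u)) /\
  (forall I : set (arr G -> R), galg_ideal I ->
     exists (J : Type) (u : J -> obj G)
            (M : forall j : J, lmodType (grpRing R (isot (u j)))),
       I = \bigcap_(j in [set: J]) ann_ind (M j)).
Proof.
split=> [E|I Iideal]; first exact: ann_gammacE.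
exists (obj G), id, (ideal_quot ampleG Iideal); exact: ideal_eq_ann.
Qed.
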